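(* Let $k$, $j$, $n$ (with $j\le n$), $M$ and $N$ be positive integers. If $F\in M_k(\Gamma_1^{(n)}(N))$, then $F|A^{(j)}(M)\in M_k(\Gamma_1^{(n)}(NM^2))$. In particular, if $F\in M_k(\Gamma_0^{(n)}(N),\chi)$ for a Dirichlet character $\chi$ modulo $N$, then $F|A^{(j)}(M)\in M_k(\Gamma_0^{(n)}(NM^2),\chi)$.
   Context: $\Lambda_n$ is the set of symmetric rational $n\times n$ matrices with integral diagonal and half-integral off-diagonal entries. $\Gamma_1^{(n)}(N)=\{\begin{pmatrix}A&B\\C&D\end{pmatrix}\in\mathrm{Sp}_n(\mathbb{Z}): C\equiv0_n,\ A\equiv D\equiv 1_n\bmod N\}$ and $\Gamma_0^{(n)}(N)=\{\begin{pmatrix}A&B\\C&D\end{pmatrix}\in\mathrm{Sp}_n(\mathbb{Z}): C\equiv0_n\bmod N\}$. For a Dirichlet character $\chi$ mod $N$, $M_k(\Gamma,\chi)$ is the space of holomorphic $F$ on $\mathbb{H}_n$ with $\det(CZ+D)^{-k}F((AZ+B)(CZ+D)^{-1})=\chi(\det D)F(Z)$ for all $\begin{pmatrix}A&B\\C&D\end{pmatrix}\in\Gamma$ (plus cusp condition if $n=1$); $M_k(\Gamma)$ is the case of trivial $\chi$. Forms for $\Gamma_1^{(n)}(N)$ have Fourier expansions $F=\sum_{T\in\Lambda_n}a_F(T)e^{2\pi i\,\mathrm{tr}(TZ)}$. For $T\in\Lambda_n$, $T^{[j]}$ is the $\binom{n}{j}\times\binom nj$ matrix of all $j\times j$ minors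 of $T$, and $F|A^{(j)}(M):=\sum_{T\in\Lambda_n,\ T^{[j]}\equiv 0\bmod M}a_F(T)e^{2\pi i\,\mathrm{tr}(TZ)}$, the sum over those $T$ for which every entry of $T^{[j]}$ is congruent to $0$ modulo $M$.
   Formalization: ''Every entry of T^{[j]} is congruent to 0 modulo M'' is read, for even M, as: each j×j minor of T lies in M·2^{-j}Z (in M·2^{1-j}Z for principal minors, j odd); for j=1 this is T∈MΛ_n. With entries required to lie in MZ the claim fails (n=M=2, j=N=1, F=E_4). *)

(* Defs.v *)
From HB Require Import structures.
From mathcomp Require Import all_boot all_order all_algebra.
From mathcomp Require Import finmap complex ring.
From mathcomp Require Import all_classical all_reals all_analysis.
From mathcomp.analysis.showcase Require Import summability.

Set Implicit Arguments.
Unset Strict Implicit.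
Unset Printing Implicit Defensive.
Import Order.TTheory GRing.Theory Num.Theory.
Import numFieldNormedType.Exports.

Local Open Scope classical_set_scope.
Local Open Scope ring_scope.
Local Open Scope complex_scope.

(* The metric topology of the complex numbers. *)
HB.instance Definition _ (R : rcfType) :=
  NormedModule.copy R[i] ((R[i] : numFieldType)^o).

Section SymplecticGroup.
Variable n : nat.
Implicit Types (N : nat) (g : 'M[int]_(n + n)).

Definition symplectic_form : 'M[int]_(n + n) :=
  block_mx 0 1%:M (- 1%:M) 0.

Definition Sp : set 'M[int]_(n + n) :=
  [set g | g^T *m symplectic_form *m g = symplectic_form].

Definition mx_congr N (A B : 'M[int]_n) : Prop :=
  forall i j, (A i j = B i j %[mod N])%Z.

Definition Gamma0 N : set 'M[int]_(n + n) :=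
  [set g | Sp g /\ mx_congr N (dlsubmx g) 0].

Definition Gamma1 N : set 'M[int]_(n + n) :=
  [set g | [/\ Sp g, mx_congr N (dlsubmx g) 0,
               mx_congr N (ulsubmx g) 1%:M & mx_congr N (drsubmx g) 1%:M]].

End SymplecticGroup.

Arguments Sp : clear implicits.
Arguments Gamma0 : clear implicits.
Arguments Gamma1 : clear implicits.

Section Forms.
Variables (R : realType) (n : nat).
Local Notation C := R[i].
Implicit Types (F : 'M[C]_n -> C) (Z : 'M[C]_n) (g : 'M[int]_(n + n)).

Definition dirichlet_character (N : nat) (chi : int -> C) : Prop :=
  [/\ chi 1 = 1,
      forall a b, chi (a * b) = chi a * chi b,
      forall a, chi (a + N%:Z) = chi a &
      forall a, (chi a != 0) = coprimez a N%:Z].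

Definition posdef (Y : 'M[R]_n) : Prop :=
  forall v : 'cV[R]_n, v != 0 -> 0 < (v^T *m Y *m v) 0 0.

Definition siegel_space : set 'M[C]_n :=
  [set Z | Z^T = Z /\ posdef (map_mx (@complex.Im R) Z)].

(* Complex Frechet differentiability on the open subset [siegel_space] of the
   space of symmetric matrices; the increments are therefore symmetric. *)
Definition siegel_holomorphic F : Prop :=
  forall Z, siegel_space Z -> exists L : {linear 'M[C]_n -> C},
    forall e : C, 0 < e ->
      \forall H \near within [set H | H^T = H] (nbhs (0 : 'M[C]_n)),
        `|F (Z + H) - F Z - L H| <= e * `|H|.

Definition automorphy g Z : 'M[C]_n :=
  map_mx intr (dlsubmx g) *m Z + map_mx intr (drsubmx g).

Definition moebius g Z : 'M[C]_n :=
  (map_mx intr (ulsubmx g) *m Z + map_mx intr (ursubmx g))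
    *m invmx (automorphy g Z).

Definition slash (k : nat) F g Z : C :=
  (\det (automorphy g Z)) ^- k * F (moebius g Z).

(* Regularity at all cusps, only required for [n = 1]: each F|_k g is bounded
   as Im Z tends to infinity. *)
Definition bounded_at_cusps (k : nat) F : Prop :=
  forall g, Sp n g -> exists y B : R,
    forall Z, siegel_space Z -> (forall i, y <= complex.Im (Z i i)) ->
      `|slash k F g Z| <= B%:C.

Definition modular_forms (k : nat) (Gamma : set 'M[int]_(n + n))
    (chi : int -> C) : set ('M[C]_n -> C) :=
  [set F | [/\ siegel_holomorphic F,
      forall g, Gamma g -> forall Z, siegel_space Z ->
        slash k F g Z = chi (\det (drsubmx g)) * F Z &
      n = 1%N -> bounded_at_cusps k F]].

End Forms.

Definition half_integral (n : nat) : set 'M[rat]_n :=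
  [set T | [/\ T^T = T, forall i, T i i \is a Num.int
             & forall i j, 2 * T i j \is a Num.int]].

Section Compound.
Variables (n j : nat).

(* The a-th j-element subset of the index set, listed in increasing order. *)
Definition minor_index (a : 'I_'C(n, j)) : j.-tuple 'I_n :=
  enum_val (cast_ord (esym (card_ltn_sorted_tuples j n)) a).

Definition compound (A : 'M[rat]_n) : 'M[rat]_'C(n, j) :=
  \matrix_(a, b) \det (mxsub (tnth (minor_index a)) (tnth (minor_index b)) A).

(* As T ranges over the half-integral matrices, the entries of [compound T] in
   position (a, b) span the lattice (1 / minor_denom a b)Z: the entries of 2T
   are integers, and a principal minor of odd size of 2T is even because 2T has
   an even diagonal. *)
Definition minor_denom (a b : 'I_'C(n, j)) : nat :=
  (if (a == b) && odd j then 2 ^ j.-1 else 2 ^ j)%N.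

(* The entries may have powers of 2 in the denominator, so their congruence
   modulo M is meant in the lattice in which each of them lives: x = 0 mod M
   iff x belongs to M (1 / minor_denom a b)Z.  For n = 1 this is divisibility
   of an integer, for j = 1 it says that T is M times a half-integral matrix
   ([compound_congr0_1]), and for odd M it says that M divides the numerators
   of all entries ([compound_congr0_odd]).  For every M it depends only on T
   modulo M times the half-integral matrices; for even M the divisibility of
   the numerators does not. *)
Definition compound_congr0 (M : nat) (T : 'M[rat]_n) : Prop :=
  forall a b, compound T a b * (minor_denom a b)%:R / M%:R \is a Num.int.

End Compound.

Lemma det_odd_alternating_even (j : nat) (X : 'M[int]_j) :
  odd j -> X^T = X -> (forall i, (2 %| X i i)%Z) -> (2 %| \det X)%Z.
Proof.
move=> oj sX dX.
pose Y : 'M[int]_j := \matrix_(a, b)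
  (if (a < b)%N then X a b else if (b < a)%N then - X a b else 0).
have YT : Y^T = - Y.
  apply/matrixP => a b; rewrite !mxE.
  have -> : X b a = X a b by rewrite -[in LHS]sX mxE.
  by case: ltngtP; rewrite ?opprK ?oppr0.
have dY : \det Y = 0.
  have /eqP : \det Y = - \det Y.
    by rewrite -[LHS]det_tr YT -scaleN1r detZ -signr_odd oj expr1 mulN1r.
  by rewrite -addr_eq0 -mulr2n mulrn_eq0 => /eqP.
have XY : map_mx (intr : int -> 'F_2) X = map_mx (intr : int -> 'F_2) Y.
  have N2 (x : int) : (- x)%:~R = x%:~R :> 'F_2.
    rewrite rmorphN; apply/eqP; rewrite eq_sym -addr_eq0 -mulr2n.
    by rewrite -mulr_natl (_ : 2%:R = 0 :> 'F_2) ?mul0r//; exact/val_inj.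
  apply/matrixP => a b; rewrite !mxE.
  have [ab|ab|/val_inj ab] := ltngtP a b; first by [].
    by rewrite N2.
  rewrite -ab.
  have /dvdzP[q ->] := dX a.
  by rewrite intrM (_ : 2%:~R = 0 :> 'F_2) ?mulr0//; exact/val_inj.
rewrite (dvdz_pcharf (pchar_Fp (isT : prime 2))) -det_map_mx.
by rewrite XY det_map_mx dY.
Qed.

Lemma half_integral_dbl n (T : 'M[rat]_n) : half_integral T ->
  exists X : 'M[int]_n, [/\ 2 *: T = map_mx intr X, X^T = X
                          & forall i, (2 %| X i i)%Z].
Proof.
move=> [sT dT oT]; exists (\matrix_(i, j) Num.floor (2 * T i j)); split.
- by apply/matrixP => i j; rewrite !mxE floorK ?oT.
- by apply/matrixP => i j; rewrite !mxE -[in LHS]sT mxE.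
- move=> i; rewrite mxE; have /intrP[m ->] := dT i.
  have -> : 2 * m%:~R = (2 * m)%:~R :> rat by rewrite intrM.
  by rewrite intrKfloor dvdz_mulr.
Qed.

Lemma compound_minor_denom_int n j (T : 'M[rat]_n) (a b : 'I_'C(n, j)) :
  half_integral T ->
  compound j T a b * (minor_denom a b)%:R \is a Num.int.
Proof.
move=> /half_integral_dbl[X [TX sX dX]].
have E : compound j T a b * (2 ^ j)%:R =
    (\det (mxsub (tnth (minor_index a)) (tnth (minor_index b)) X))%:~R.
  rewrite mxE -det_map_mx natrX mulrC -detZ; congr (\det _).
  by apply/matrixP => u v; have /matrixP/(_ (tnth (minor_index a) u)
    (tnth (minor_index b) v)) := TX; rewrite !mxE.
rewrite /minor_denom; case: ifPn => [/andP[/eqP ab oj]|_]; last first.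
  by rewrite E intr_int.
move: E; subst b => E.
have /dvdzP[q Eq] : (2 %| \det (mxsub (tnth (minor_index a))
    (tnth (minor_index a)) X))%Z.
  apply: det_odd_alternating_even => //.
    by apply/matrixP => u v; rewrite !mxE -[in LHS]sX mxE.
  by move=> i; rewrite mxE dX.
have j0 : (0 < j)%N by case: (j) oj.
suff -> : compound j T a a * (2 ^ j.-1)%:R = q%:~R by rewrite intr_int.
apply: (@mulIf _ 2) => //.
by rewrite -mulrA -natrM -expnSr prednK // E Eq intrM.
Qed.

Lemma compound_congr0_odd n j M (T : 'M[rat]_n) : odd M -> half_integral T ->
  compound_congr0 j M T <->
  (forall a b : 'I_'C(n, j), (M %| numq (compound j T a b))%Z).
Proof.
move=> oM hT; have M0 : M%:R != 0 :> rat by rewrite pnatr_eq0; case: (M) oM.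
have cop (a b : 'I_'C(n, j)) : coprimez M%:Z (minor_denom a b)%:Z.
  rewrite coprimezE !absz_nat /minor_denom.
  by case: ifP => _; rewrite coprime_sym coprimeXl ?coprime2n.
suff H (a b : 'I_'C(n, j)) :
    (compound j T a b * (minor_denom a b)%:R / M%:R \is a Num.int) = (M %| numq (compound j T a b))%Z.
  by split => H' a b; have := H' a b; rewrite H.
have := compound_minor_denom_int a b hT; have := cop a b.
move: (compound j T a b) (minor_denom a b) => x d coMd xd.
have dx0 : (denq x)%:~R != 0 :> rat by rewrite intr_eq0 denq_eq0.
apply/idP/idP => [/intrP[z Ez]|/dvdzP[p Ep]].
  have E : x * d%:R = z%:~R * M%:R by rewrite -Ez divfK.
  have {}E : numq x * d%:Z = z * M%:Z * denq x.
    apply: (@intr_inj rat); rewrite !intrM -!pmulrn.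
    by rewrite numqE -E mulrAC.
  by rewrite -(Gauss_dvdzl _ coMd) E mulrAC dvdz_mull.
have /intrP[w Ew] := xd.
have {}Ew : numq x * d%:Z = w * denq x.
  apply: (@intr_inj rat); rewrite !intrM -!pmulrn -Ew.
  by rewrite numqE mulrAC.
have /dvdzP[v Ev] : (denq x %| d%:Z)%Z.
  have c : coprimez (denq x) (numq x).
    by rewrite coprimezE coprime_sym coprime_num_den.
  by rewrite -(Gauss_dvdzr _ c) Ew dvdz_mull.
apply/intrP; exists (p * v).
rewrite -[in LHS](divq_num_den x) Ep !intrM -[d%:R]/(d%:Z%:~R) Ev.
rewrite intrM -!pmulrn.
by field; rewrite dx0 M0.
Qed.

Lemma compound_congr0_1 n M (T : 'M[rat]_n) : (0 < M)%N -> half_integral T ->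
  compound_congr0 1 M T <->
  exists2 T' : 'M[rat]_n, half_integral T' & T = M%:R *: T'.
Proof.
move=> M_gt0 [sT dT oT].
have M0 : M%:R != 0 :> rat by rewrite pnatr_eq0 -lt0n.
have cE (a b : 'I_'C(n, 1)) :
    compound 1 T a b = T (thead (minor_index a)) (thead (minor_index b)).
  by rewrite mxE det_mx11 mxE.
have surj i : exists a : 'I_'C(n, 1), thead (minor_index a) = i.
  have it : [tuple i] \in [set t : 1.-tuple 'I_n | sorted ltn (map val t)]%SET.
    by rewrite inE.
  exists (cast_ord (card_ltn_sorted_tuples 1 n) (enum_rank_in it [tuple i])).
  by rewrite /minor_index cast_ordK enum_rankK_in.
split=> [H|[T' [sT' dT' oT'] ->] a b].
  exists (M%:R^-1 *: T); last by rewrite scalerA divff ?scale1r.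
  split; first by rewrite linearZ /= sT.
    move=> i; have [a <-] := surj i.
    by have := H a a; rewrite cE /minor_denom eqxx /= mulr1 mxE mulrC.
  move=> i k; have [a <-] := surj i; have [b <-] := surj k.
  have := H a b; rewrite cE /minor_denom /= mxE.
  case: eqP => [<-|_] /=.
    by rewrite mulr1 [_ / _]mulrC => h; rewrite rpredM.
  by rewrite mulrCA [M%:R^-1 * _]mulrC [2 * _]mulrC.
rewrite mxE det_mx11 !mxE /minor_denom.
case: eqP => [<-|_] /=.
  by rewrite mulr1 mulrAC divff// mul1r dT'.
by rewrite mulrAC [_ * _ / _]mulrAC divff// mul1r mulrC oT'.
Qed.

Section FourierExpansion.
Variables (R : realType) (n : nat).
Local Notation C := R[i].
Implicit Types (F : 'M[C]_n -> C) (Z : 'M[C]_n) (T : 'M[rat]_n).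

Definition cexp (z : C) : C :=
  (expR (complex.Re z))%:C * (cos (complex.Im z) +i* sin (complex.Im z)).

Definition fourier_char T Z : C :=
  cexp ((0 +i* (2 * pi)) * \tr (map_mx ratr T *m Z)).

Definition fourier_term (D : set 'M[rat]_n) (a : 'M[rat]_n -> C) Z T : C :=
  if `[< D T >] then a T * fourier_char T Z else 0.

Definition fourier_expansion F (a : 'M[rat]_n -> C) : Prop :=
  forall Z, siegel_space Z ->
    partial_sum (fourier_term (@half_integral n) a Z) @ totally --> F Z.

(* The expansion exists for every form on a group Gamma1 N, and it determines
   the coefficients at the half-integral matrices; the values elsewhere are
   never used. *)
Definition fourier_coef F : 'M[rat]_n -> C :=
  xget (fun=> 0) [set a | fourier_expansion F a].

Definition minor_congr_part (j M : nat) F Z : C :=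
  sum (fourier_term (@half_integral n `&` compound_congr0 j M)
         (fourier_coef F) Z).

End FourierExpansion.

(* Main.v *)
From HB Require Import structures.
Require Import Defs.
From mathcomp Require Import all_boot all_order all_algebra.
From mathcomp Require Import fingroup perm.
From mathcomp Require Import finmap complex.
From mathcomp Require Import all_classical all_reals all_analysis.
From mathcomp Require Import ring lra.
From mathcomp.analysis.showcase Require Import summability.

Set Implicit Arguments.
Unset Strict Implicit.
Unset Printing Implicit Defensive.
Import Order.TTheory GRing.Theory Num.Theory.
Import numFieldNormedType.Exports.

Local Open Scope ring_scope.
Local Open Scope complex_scope.

(** The condition on T depends only on T modulo M times the half-integral
    matrices, so its indicator is a combination of the characters
    T |-> e(tr(TX)/M), X symmetric integral modulo M, and F|A^(j)(M) is the
    corresponding combination of the shifts F(Z + X/M).  For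
    g = (A B; C D) with C = 0 mod NM^2 one has t(X/M) g = g' t(X'/M) with
    X' = D^T X D and g' integral, congruent to g modulo N; hence g permutes the
    shifts, and it fixes the weights because T |-> D T D^T preserves the
    condition (each minor of D T D^T is an integral combination of minors of T).
    If F had no Fourier expansion, all coefficients would be 0 by convention and
    the assertion trivial, so the existence of the expansion is not needed. *)

(** * Divisibility of minors *)

(** The upper right block of t(X/M) g t(-X'/M) is B + (XD - AX')/M - XCX'/M^2. Integrality of the
    last term asks for C divisible by M^2, while keeping the diagonal blocks congruent to those of g
    modulo N asks for NM; the level NM^2 covers both. The choice X' = D^T X D is dictated by the
    middle term: A D^T = 1 + B C^T makes A X' congruent to X D modulo M. The prime 2 shapes the
    finite part. After doubling T, principal minors of odd size are tested modulo 2M and all others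
    modulo M, so each invariance has to keep track of one extra factor 2: by a polynomial argument
    under T |-> T + M T', by pairing symmetric terms under T |-> P^T T P. Half-integral T are
    written (U + U^T)/2 with U integral, so that all characters are tr(UX) modulo M and no dual
    lattice appears; the redundancy of U only enlarges the constant of the Fourier inversion. The
    identity with the sum of shifts is available on the Siegel space only, so holomorphy is
    transferred through the openness of that space. For n = 1 the shift by X/M is not in SL_2(Z) and
    may move one cusp to another, hence a separate argument for regularity. *)

Section Determinants.
Variable R : comNzRingType.

(** Congruence modulo c respects the sums and products of the Leibniz formula. The ring is general
    because the moduli M and N over the integers and the modulus 2 over [{poly int}] all occur. *)
Lemma det_congr m (c : R) (A B : 'M[R]_m) :
  (forall i j, exists q, A i j = B i j + c * q) ->
  exists q, \det A = \det B + c * q.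
Proof.
move=> AB; pose K (x y : R) := exists q, x = y + c * q.
have KM x y x' y' : K x x' -> K y y' -> K (x * y) (x' * y').
  move=> [p ->] [q ->]; exists (p * y' + x' * q + c * p * q); ring.
rewrite /determinant; apply: (big_ind2 K) => [|x x' y y' [p ->] [q ->]|s _].
- by exists 0; rewrite mulr0 addr0.
- by exists (p + q); ring.
- apply: (KM _ _ _ _ _ _); first by exists 0; rewrite mulr0 addr0.
  apply: (big_ind2 K) => [|x x' y y' Kx Ky|i _]; last by rewrite /K.
    by exists 0; rewrite mulr0 addr0.
  exact: KM.
Qed.

(** Cauchy-Binet before collecting terms: [h] runs over all maps, the non-injective ones
    contributing 0. No index set has to be sorted. *)
Lemma det_mulmx_rowsub m n (A : 'M[R]_(m, n)) (B : 'M[R]_(n, m)) :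
  \det (A *m B) =
  \sum_(h : {ffun 'I_m -> 'I_n}) (\prod_i A i (h i)) * \det (rowsub h B).
Proof.
rewrite /determinant.
under eq_bigr => s _.
  under eq_bigr => i _ do rewrite mxE.
  rewrite bigA_distr_bigA mulr_sumr /=.
  over.
rewrite exchange_big /=; apply: eq_bigr => h _; rewrite mulr_sumr.
apply: eq_bigr => s _; rewrite big_split /= mulrCA; congr (_ * (_ * _)).
by apply: eq_bigr => i _; rewrite !mxE.
Qed.

Lemma det_mulmx_mxsub m n (A : 'M[R]_(m, n)) (Y : 'M[R]_n) (B : 'M[R]_(n, m)) :
  \det (A *m Y *m B) =
  \sum_(h : {ffun 'I_m -> 'I_n}) \sum_(g : {ffun 'I_m -> 'I_n})
    (\prod_i A i (h i)) * (\prod_i B (g i) i) * \det (mxsub h g Y).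
Proof.
rewrite -mulmxA det_mulmx_rowsub; apply: eq_bigr => h _.
have -> : rowsub h (Y *m B) = (B^T *m (rowsub h Y)^T)^T.
  by rewrite -trmx_mul trmxK; apply/matrixP => i k; rewrite !mxE;
     apply: eq_bigr => l _; rewrite !mxE.
rewrite det_tr det_mulmx_rowsub mulr_sumr; apply: eq_bigr => g _.
rewrite mulrA; congr (_ * _ * _).
  by apply: eq_bigr => i _; rewrite mxE.
by rewrite -det_tr; congr (\det _); apply/matrixP => i k; rewrite !mxE.
Qed.

End Determinants.

(** Modulo 2 such an [X] equals the skew matrix [Y], whose determinant is its own opposite in odd
    order. A general domain is allowed so that [X] may have polynomial entries. *)
Lemma det_odd_sym_even (R : idomainType) m (X : 'M[R]_m) :
  2 != 0 :> R -> odd m -> X^T = X -> (forall i, exists d, X i i = 2 * d) ->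
  exists q, \det X = 2 * q.
Proof.
move=> nz2 om sX dX.
pose Y : 'M[R]_m := \matrix_(a, b)
  (if (a < b)%N then X a b else if (b < a)%N then - X a b else 0).
have YT : Y^T = - Y.
  apply/matrixP => a b; rewrite !mxE.
  have -> : X b a = X a b by rewrite -[in LHS]sX mxE.
  by case: ltngtP; rewrite ?opprK ?oppr0.
have dY : \det Y = 0.
  have /eqP : \det Y = - \det Y.
    by rewrite -[LHS]det_tr YT -scaleN1r detZ -signr_odd om expr1 mulN1r.
  by rewrite -addr_eq0 -mulr2n -mulr_natl mulf_eq0 (negbTE nz2) => /eqP.
have [|q ->] := @det_congr _ _ 2 X Y; last by exists q; rewrite dY add0r.
move=> a b; rewrite mxE; have [ab|ab|/val_inj ab] := ltngtP a b.
- by exists 0; ring.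
- by exists (X a b); ring.
- by have [d Ed] := dX a; exists d; rewrite -ab Ed add0r.
Qed.

Section MinorsDivide.
Variables (n j : nat).
Implicit Types (M : int) (Y : 'M[int]_n).

(** These are exactly the doubles of half-integral matrices. *)
Definition even_sym m (Y : 'M[int]_m) : Prop :=
  Y^T = Y /\ forall i, (2 %| Y i i)%Z.

(* For Y = 2T this is [compound_congr0 j M T], but with arbitrary index maps
   in place of increasing ones. *)
Definition minors_divide M Y : Prop :=
  forall f g : 'I_j -> 'I_n, (M %| \det (mxsub f g Y))%Z /\
    (odd j -> (M * 2 %| \det (mxsub f f Y))%Z).

(* Over Z[t] the determinant of an odd principal block of Y + tY' is even, so
   its values at t = M and t = 0 differ by a multiple of 2M. *)
Lemma minors_divide_shift M Y Y' : even_sym Y -> even_sym Y' ->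
  minors_divide M Y -> minors_divide M (Y + M *: Y').
Proof.
move=> [sY dY] [sY' dY'] H f g; split.
  have [|q ->] := @det_congr _ _ M (mxsub f g (Y + M *: Y')) (mxsub f g Y).
    by move=> a b; exists (Y' (f a) (g b)); rewrite !mxE.
  by rewrite rpredD ?dvdz_mulr //; have [] := H f g.
move=> oj; pose P : 'M[{poly int}]_j :=
  map_mx polyC (mxsub f f Y) + 'X *: map_mx polyC (mxsub f f Y').
have PE t : \det (mxsub f f (Y + t *: Y')) = (\det P).[t].
  rewrite -[RHS]/(horner_eval t (\det P)) -det_map_mx; congr (\det _).
  apply/matrixP => a b; rewrite !mxE /=.
  by rewrite /horner_eval !hornerE.
have [||a|q Eq] := @det_odd_sym_even _ _ P _ oj.
- by rewrite -polyC_natr polyC_eq0.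
- apply/matrixP => a b; rewrite !mxE.
  by rewrite -[in LHS]sY -[in LHS]sY' !mxE.
- have /dvdzP[u Eu] := dY (f a); have /dvdzP[v Ev] := dY' (f a).
  exists (u%:P + 'X * v%:P); rewrite !mxE Eu Ev !rmorphM /=.
  by rewrite -[2%:P]/((2%:R)%:P) polyC_natr; ring.
have : (M * 2 %| (\det P).[0])%Z.
  by rewrite -PE scale0r addr0; have [_] := H f f; apply.
rewrite PE Eq; elim/poly_ind: q {Eq} => [|q c _]; rewrite !hornerE //=.
move=> dc.
rewrite mulrDr rpredD //; apply/dvdzP; exists q.[M]; ring.
Qed.

(** The off-diagonal terms come in equal pairs, which supplies the factor 2; only the diagonal terms
    must bring it themselves. *)
Lemma dvdz_sum_sym (I : Type) (s : seq I) (S : I -> I -> int) M :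
  (forall h g, S h g = S g h) -> (forall h g, (M %| S h g)%Z) ->
  (forall h, (M * 2 %| S h h)%Z) ->
  (M * 2 %| \sum_(h <- s) \sum_(g <- s) S h g)%Z.
Proof.
move=> symS dS dSS; elim: s => [|h s IH]; first by rewrite big_nil dvdz0.
rewrite big_cons; under eq_bigr => k _ do rewrite big_cons.
rewrite big_cons big_split /= addrA rpredD // -addrA rpredD //.
under [X in _ + X]eq_bigr => k _ do rewrite symS.
have /dvdzP[q ->] : (M %| \sum_(g <- s) S h g)%Z by rewrite rpred_sum.
by apply/dvdzP; exists q; ring.
Qed.

(** By the unreduced Cauchy-Binet formula a minor of the new matrix is an integral combination of
    minors of [Y]. For a principal minor the summand is symmetric in the two index maps, so
    [dvdz_sum_sym] yields the modulus [M * 2]. *)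
Lemma minors_divide_congruence M Y (P : 'M[int]_n) : Y^T = Y ->
  minors_divide M Y -> minors_divide M (P^T *m Y *m P).
Proof.
move=> sY H f g.
have E (f1 g1 : 'I_j -> 'I_n) : mxsub f1 g1 (P^T *m Y *m P) =
    (colsub f1 P)^T *m Y *m colsub g1 P.
  apply/matrixP => a b; rewrite !mxE; apply: eq_bigr => l _; rewrite !mxE.
  by congr (_ * _); apply: eq_bigr => m _; rewrite !mxE.
split=> [|oj]; rewrite E det_mulmx_mxsub.
  rewrite !rpred_sum // => h _; rewrite rpred_sum // => k _.
  by rewrite dvdz_mull //; have [] := H h k.
apply: dvdz_sum_sym => [h k|h k|h].
- have -> : mxsub k h Y = (mxsub h k Y)^T.
    by apply/matrixP => a b; rewrite !mxE -[in LHS]sY mxE.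
  rewrite det_tr; congr (_ * _); rewrite mulrC; congr (_ * _).
    by apply: eq_bigr => i _; rewrite !mxE.
  by apply: eq_bigr => i _; rewrite !mxE.
- by rewrite dvdz_mull //; have [] := H h k.
- by rewrite dvdz_mull //; have [_] := H h h; apply.
Qed.

Lemma injective_minor_index (f : 'I_j -> 'I_n) : injective f ->
  exists (a : 'I_'C(n, j)) (s : 'S_j), f =1 tnth (minor_index a) \o s.
Proof.
move=> injf; pose t := sort_tuple (relpre val leq) [tuple f i | i < j].
have st : t \in [set t : j.-tuple 'I_n | sorted ltn (map val t)]%SET.
  rewrite inE ltn_sorted_uniq_leq map_inj_uniq; last exact: val_inj.
  rewrite sort_uniq /= map_inj_uniq ?enum_uniq //=.
  rewrite sorted_map; apply: sort_sorted => x y; exact: leq_total.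
have /tuple_permP[s Es] : perm_eq [tuple f i | i < j] t.
  by rewrite perm_sym perm_sort.
exists (cast_ord (card_ltn_sorted_tuples j n) (enum_rank_in st t)), s => i /=.
rewrite /minor_index cast_ordK enum_rankK_in //.
have /(congr1 (fun u => tnth u i)) : [tuple f i | i < j] = [tuple tnth t (s i) | i < j].
  exact: val_inj.
by rewrite !tnth_mktuple.
Qed.

Lemma det_mxsub_noninj (f g : 'I_j -> 'I_n) Y :
  ~ injective f -> \det (mxsub f g Y) = 0.
Proof.
move=> /injectiveP/injectivePn[x [y xy fxy]].
by apply: (determinant_alternate xy) => k; rewrite !mxE fxy.
Qed.

(** A minor of Y/2 is [2^-j] times that of [Y]; against [minor_denom] this leaves the modulus [M],
    or [M * 2] for principal minors of odd size. Passing from increasing to arbitrary index maps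
    changes a minor by a sign or makes it 0, and the two signs cancel for a principal minor. *)
Lemma compound_congr0P M Y : even_sym Y -> (0 < M)%R ->
  compound_congr0 j `|M|%N (2^-1 *: map_mx intr Y) <-> minors_divide M Y.
Proof.
move=> [sY dY] M0.
have M0' : `|M|%:R != 0 :> rat.
  by rewrite pnatr_eq0 absz_eq0 gt_eqF.
have ME : M%:~R = `|M|%:R :> rat by rewrite -[in LHS](gtz0_abs M0).
have intP (z c : int) : c != 0 ->
    (z%:~R / c%:~R \is a @Num.int rat) = (c %| z)%Z.
  move=> c0; have c0' : c%:~R != 0 :> rat by rewrite intr_eq0.
  apply/idP/idP => [/intrP[q Eq]|/dvdzP[q ->]].
    apply/dvdzP; exists q; apply: (@intr_inj rat).
    by rewrite intrM -Eq divfK.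
  by rewrite intrM mulfK // intr_int.
have E (a b : 'I_'C(n, j)) : compound j (2^-1 *: map_mx intr Y) a b =
    2^-1 ^+ j * (\det (mxsub (tnth (minor_index a)) (tnth (minor_index b)) Y))%:~R.
  rewrite mxE -det_map_mx -detZ; congr (\det _).
  by apply/matrixP => u v; rewrite !mxE.
have C (a b : 'I_'C(n, j)) :
    (compound j (2^-1 *: map_mx intr Y) a b * (minor_denom a b)%:R / `|M|%:R
       \is a Num.int) =
    ((if (a == b) && odd j then M * 2 else M) %|
       \det (mxsub (tnth (minor_index a)) (tnth (minor_index b)) Y))%Z.
  rewrite E -intP; last by case: ifP; rewrite ?mulf_neq0 ?(gt_eqF M0).
  congr (_ \is a Num.int); rewrite /minor_denom.
  case: ifP => [/andP[_ oj]|_]; rewrite natrX ?intrM ME.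
    have -> : 2^-1 ^+ j = 2^-1 ^+ j.-1 / 2 :> rat.
      by rewrite -exprSr prednK ?odd_gt0.
    by rewrite exprVn; field; rewrite expf_neq0 // M0'.
  by rewrite exprVn; field; rewrite expf_neq0 // M0'.
split=> [H f g|H a b]; last first.
  rewrite C; case: ifP => [/andP[/eqP<- oj]|_]; first by have [_] := H (tnth (minor_index a)) (tnth (minor_index a)); apply.
  by have [] := H (tnth (minor_index a)) (tnth (minor_index b)).
have key (f1 g1 : 'I_j -> 'I_n) a b (s t : 'S_j) :
    f1 =1 tnth (minor_index a) \o s -> g1 =1 tnth (minor_index b) \o t ->
    \det (mxsub f1 g1 Y) = (-1) ^+ s * (-1) ^+ t *
     \det (mxsub (tnth (minor_index a)) (tnth (minor_index b)) Y).
  move=> Ef Eg; have -> : mxsub f1 g1 Y = row_perm s (col_perm t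
      (mxsub (tnth (minor_index a)) (tnth (minor_index b)) Y)).
    by apply/matrixP => u v; rewrite !mxE Ef Eg.
  move: (mxsub _ _ Y) => D.
  by rewrite row_permE col_permE !det_mulmx !det_perm odd_permV [\det D * _]mulrC mulrA.
have [injf|/det_mxsub_noninj nf] := pselect (injective f); last by rewrite !nf !dvdz0.
have [a [s Ef]] := injective_minor_index injf; split; last first.
  move=> oj; rewrite (key _ _ _ _ _ _ Ef Ef) -signr_addb addbb mul1r.
  by have := H a a; rewrite C eqxx oj.
have [injg|/det_mxsub_noninj ng] := pselect (injective g); last first.
  have -> : mxsub f g Y = (mxsub g f Y)^T.
    by apply/matrixP => u v; rewrite !mxE -[in LHS]sY mxE.
  by rewrite det_tr ng dvdz0.
have [b [t Eg]] := injective_minor_index injg.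
rewrite (key _ _ _ _ _ _ Ef Eg) dvdz_mull //.
by have := H a b; rewrite C; case: ifP => // _; apply: dvdz_trans; rewrite dvdz_mulr.
Qed.

End MinorsDivide.

(** * Sums over matrices modulo M *)

Section MatricesModulo.
Variables (n m : nat).
Local Notation M := (m.+1%:Z).
Implicit Types (U V W : 'M[int]_n) (X : 'M['I_m.+1]_n).

Definition mx_cong U V := exists W, U = V + M *: W.

(** The modulus is written [m.+1], so that its positivity is built into the finite type of
    residues. *)
Definition mx_rep X : 'M[int]_n := map_mx (fun i : 'I_m.+1 => (i : nat)%:Z) X.

Definition mx_red V : 'M['I_m.+1]_n := map_mx (fun x => inord `|(x %% M)%Z|) V.

Lemma mx_cong_refl V : mx_cong V V.
Proof. by exists 0; rewrite scaler0 addr0. Qed.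

Lemma mx_cong_sym U V : mx_cong U V -> mx_cong V U.
Proof. by move=> [W ->]; exists (- W); rewrite scalerN addrK. Qed.

Lemma mx_cong_trans U V W : mx_cong U V -> mx_cong V W -> mx_cong U W.
Proof. by move=> [A ->] [B ->]; exists (B + A); rewrite scalerDr addrA. Qed.

Lemma mx_cong_mul U V U' V' :
  mx_cong U V -> mx_cong U' V' -> mx_cong (U *m U') (V *m V').
Proof.
move=> [A ->] [B ->]; exists (V *m B + A *m V' + A *m (M *: B)).
rewrite mulmxDl !mulmxDr !scalerDr -!scalemxAr -!scalemxAl !addrA //.
Qed.

Lemma mx_cong_tr U V : mx_cong U V -> mx_cong U^T V^T.
Proof. by move=> [A ->]; exists A^T; rewrite !linearD linearZ. Qed.

Lemma mx_redP U V : mx_cong U V <-> mx_red U = mx_red V.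
Proof.
split=> [[W ->]|].
  by apply/matrixP => i k; rewrite !mxE mulrC addrC modzMDl.
move=> E; exists (\matrix_(i, k) ((U i k %/ M)%Z - (V i k %/ M)%Z)).
apply/matrixP => i k; rewrite !mxE.
have : val (mx_red U i k) = val (mx_red V i k) by rewrite E.
have lt x : (`|(x %% M)%Z| < m.+1)%N by rewrite -ltz_nat gez0_abs ?modz_ge0 // ltz_pmod.
rewrite !mxE /= !inordK // => /(congr1 (fun x : nat => x%:Z)).
rewrite !gez0_abs ?modz_ge0 // => Em.
rewrite [LHS](divz_eq (U i k) M) {1}(divz_eq (V i k) M) Em; ring.
Qed.

Lemma mx_repK X : mx_red (mx_rep X) = X.
Proof.
apply/matrixP => i k; rewrite !mxE; apply/val_inj.
by rewrite modz_small ?ltz_nat ?ltn_ord //= inordK.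
Qed.

Lemma mx_rep_red V : mx_cong (mx_rep (mx_red V)) V.
Proof. by apply/mx_redP; rewrite mx_repK. Qed.

Lemma mx_rep_red_sym V : V^T == V -> (mx_rep (mx_red V))^T == mx_rep (mx_red V).
Proof.
move=> /eqP sV; apply/eqP/matrixP => i k; rewrite !mxE.
by rewrite -[in LHS]sV mxE.
Qed.

(** The left inverse [t] modulo M makes [s] injective on the residues satisfying [P], hence a
    permutation of this finite set. Invariance of [f] is asked only inside [P] because Z |-> F(Z +
    X/M) will be periodic only along symmetric integral matrices. *)
Lemma sum_reindex_mod (K : nmodType) (P : pred 'M[int]_n)
    (s t : 'M[int]_n -> 'M[int]_n) (f : 'M[int]_n -> K) :
  (forall V, P V -> P (mx_rep (mx_red V))) ->
  (forall V, P V -> P (s V)) ->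
  (forall U V, mx_cong U V -> mx_cong (t U) (t V)) ->
  (forall V, P V -> mx_cong (t (s V)) V) ->
  (forall U V, P U -> P V -> mx_cong U V -> f U = f V) ->
  \sum_(X | P (mx_rep X)) f (s (mx_rep X)) = \sum_(X | P (mx_rep X)) f (mx_rep X).
Proof.
move=> Pr Ps tc ts fc; pose A := [set X | P (mx_rep X)]%SET.
pose h X := mx_red (s (mx_rep X)).
have hinj : {in A &, injective h}.
  move=> X Y; rewrite !inE => PX PY /mx_redP/tc E.
  rewrite -(mx_repK X) -(mx_repK Y); apply/mx_redP.
  by apply: mx_cong_trans (mx_cong_sym (ts _ PX)) (mx_cong_trans E (ts _ PY)).
have hA : [set h X | X in A]%SET = A.
  apply/eqP; rewrite eqEcard card_in_imset // leqnn andbT.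
  by apply/fintype.subsetP => _ /imsetP[X XA ->]; move: XA; rewrite !inE => XA; apply/Pr/Ps.
have E g : \sum_(X | P (mx_rep X)) g X = \sum_(X in A) g X :> K.
  by apply: eq_bigl => X; rewrite inE.
rewrite [RHS]E -hA big_imset //= E; apply: eq_bigr => X; rewrite inE => PX.
by apply: fc; [exact: Ps|exact/Pr/Ps|exact/mx_cong_sym/mx_rep_red].
Qed.

Lemma sum_reindex_mod_all (K : nmodType)
    (s t : 'M[int]_n -> 'M[int]_n) (f : 'M[int]_n -> K) :
  (forall U V, mx_cong U V -> mx_cong (t U) (t V)) ->
  (forall V, mx_cong (t (s V)) V) ->
  (forall U V, mx_cong U V -> f U = f V) ->
  \sum_X f (s (mx_rep X)) = \sum_X f (mx_rep X).
Proof.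
by move=> tc ts fc; apply: (@sum_reindex_mod K predT s t f) => // *; exact: fc.
Qed.

End MatricesModulo.

(** * Additive characters modulo M *)

Section AdditiveCharacter.
Variable R : realType.
Local Notation C := R[i].

Lemma cexpD (z w : C) : cexp (z + w) = cexp z * cexp w.
Proof.
case: z w => [a b] [c d]; rewrite /cexp /= expRD cosD sinD.
by apply/eqP; rewrite eq_complex /=; apply/andP; split; apply/eqP; ring.
Qed.

Lemma cexp0 : cexp 0 = 1 :> C.
Proof. by rewrite /cexp /= expR0 cos0 sin0; apply/eqP; rewrite eq_complex /= !mul1r !mul0r !subr0 !addr0 !eqxx. Qed.

Definition mod_char (m : nat) (a : int) : C :=
  cexp ((0 +i* (2 * pi)) * (a%:~R / m.+1%:R)).

Variable m : nat.
Local Notation M := (m.+1%:Z).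
Local Notation psi := (mod_char m).

Lemma mod_charD a b : psi (a + b) = psi a * psi b.
Proof. by rewrite /mod_char -cexpD -mulrDr -mulrDl -intrD. Qed.

Lemma mod_char0 : psi 0 = 1.
Proof. by rewrite /mod_char mul0r mulr0 cexp0. Qed.

Lemma mod_charE a :
  psi a = cos (2 * (pi * (a%:~R / m.+1%:R))) +i* sin (2 * (pi * (a%:~R / m.+1%:R))).
Proof.
rewrite /mod_char.
have -> : a%:~R / m.+1%:R = (a%:~R / m.+1%:R : R)%:C :> C.
  by rewrite rmorphM /= fmorphV /= rmorph_nat rmorph_int.
rewrite /cexp /= !mul0r mulr0 subr0 expR0 add0r -[2 * pi * _]mulrA.
by rewrite mul1r.
Qed.

Lemma mod_charMl a : psi (M * a) = 1.
Proof.
have psi1 : psi M = 1.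
  rewrite mod_charE divff ?pnatr_eq0 // mulr1 mulr_natl cos2pi sin2pi.
  by [].
have nat_case (k : nat) : psi (M * k%:Z) = 1.
  elim: k => [|k IH]; first by rewrite mulr0 mod_char0.
  by rewrite -(addn1 k) PoszD mulrDr mulr1 mod_charD IH psi1 mulr1.
have [|k|k] := intP a; first by rewrite mulr0 mod_char0.
  exact: nat_case.
have : psi (M * (k.+1%:Z) + M * - k.+1%:Z) = 1 by rewrite -mulrDr subrr mulr0 mod_char0.
by rewrite mod_charD nat_case mul1r.
Qed.

Lemma mod_char_eq1 a : (psi a == 1) = (M %| a)%Z.
Proof.
apply/eqP/idP => [|/dvdzP[q ->]]; last by rewrite mulrC mod_charMl.
rewrite [X in psi X](divz_eq a M) mulrC mod_charD mod_charMl mul1r => E.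
have : 0 <= (a %% M)%Z by rewrite modz_ge0.
have : (a %% M)%Z < M by rewrite ltz_pmod.
move: E => /[swap] rM /[swap] r0 E; apply/dvdz_mod0P.
move: (a %% M)%Z rM r0 E => r rM r0; rewrite mod_charE => -[E _].
apply/eqP/contraT => nr0.
(* For a nonzero remainder r the angle y = pi r / M lies strictly between 0 and pi, so sin y > 0,
   whereas cos(2y) = 1 forces sin^2 y = 0. *)
have : 0 < sin (pi * (r%:~R / m.+1%:R) : R).
  apply: sin_gt0_pi; apply/andP; split.
    by rewrite mulr_gt0 ?pi_gt0 // divr_gt0 // ltr0z lt_neqAle eq_sym nr0.
  rewrite gtr_pMr ?pi_gt0 // ltr_pdivrMr // mul1r.
  by rewrite -[m.+1%:R]/(M%:~R) ltr_int.
move: E; rewrite mulr_natl mulr2n cosD; move: (pi * _) => y.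
have := cos2Dsin2 y; rewrite !expr2 => c2s2 E s0.
have : 0 < sin y * sin y by rewrite mulr_gt0.
suff -> : sin y * sin y = 0 by rewrite ltxx.
lra.
Qed.

End AdditiveCharacter.

(** * Finite Fourier inversion for the condition on minors *)

Section FiniteInversion.
Variables (R : realType) (n m j : nat).
Local Notation C := R[i].
Local Notation M := (m.+1%:Z).
Local Notation psi := (@mod_char R m).
Local Notation rep := (@mx_rep n m).
Implicit Types (U V W : 'M[int]_n).

Definition symmetric_mx : pred 'M[int]_n := fun V => V^T == V.

Lemma mod_char_cong (a b q : int) : a = b + M * q -> psi a = psi b.
Proof. by move=> ->; rewrite mod_charD mod_charMl mulr1. Qed.

Lemma mod_char_tr_cong U V : mx_cong m U V -> psi (\tr U) = psi (\tr V).
Proof. by move=> [W ->]; apply: (@mod_char_cong _ _ (\tr W)); rewrite linearD linearZ. Qed.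

Lemma mod_char_trN_cong U V : mx_cong m U V -> psi (- \tr U) = psi (- \tr V).
Proof.
move=> [W ->]; apply: (@mod_char_cong _ _ (- \tr W)).
by rewrite linearD linearZ opprD mulrN.
Qed.

(** The kernel of the trace pairing with symmetric matrices modulo M. Two matrices U differing by
    such a V encode the same T up to M times a half-integral matrix. *)
Definition mod_annihilates V : Prop :=
  forall W, symmetric_mx W -> (M %| \tr (V *m W))%Z.

Lemma mod_annihilates_cong U V :
  mx_cong m U V -> mod_annihilates U <-> mod_annihilates V.
Proof.
have imp U' V' : mx_cong m U' V' -> mod_annihilates U' -> mod_annihilates V'.
  move=> UV aU W sW; rewrite -(mod_char_eq1 R).
  rewrite -(mod_char_tr_cong (mx_cong_mul UV (mx_cong_refl m W))).
  by rewrite mod_char_eq1 aU.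
by move=> UV; split; apply: imp => //; exact: mx_cong_sym.
Qed.

Lemma mxtrace_mul_delta (K : pzRingType) (V : 'M[K]_n) i k :
  \tr (V *m delta_mx i k) = V k i.
Proof.
rewrite /mxtrace (bigD1 k) //= big1 => [|l lk]; rewrite mxE; last first.
  by rewrite big1 // => a _; rewrite mxE (negbTE lk) andbF mulr0.
rewrite (bigD1 i) //= mxE !eqxx mulr1 big1 ?addr0 // => a ai.
by rewrite mxE (negbTE ai) mulr0.
Qed.

(** Test against [delta_mx i i] and [delta_mx i k + delta_mx k i]. The first test gives M | [V i i]
    and not merely M | [2 * V i i], which is why the diagonal of [Y] is even. *)
Lemma mod_annihilates_even V : mod_annihilates V ->
  exists2 Y, even_sym Y & V + V^T = M *: Y.
Proof.
move=> aV.
have dd i : (M %| V i i)%Z.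
  have := aV (delta_mx i i); rewrite /symmetric_mx trmx_delta eqxx => /(_ isT).
  by rewrite mxtrace_mul_delta.
have offd i k : (M %| V i k + V k i)%Z.
  have := aV (delta_mx i k + delta_mx k i); rewrite /symmetric_mx.
  rewrite linearD /= !trmx_delta addrC eqxx mulmxDr linearD /=.
  by rewrite !mxtrace_mul_delta addrC; apply.
exists (\matrix_(i, k) if i == k then 2 * (V i i %/ M)%Z else ((V i k + V k i) %/ M)%Z).
  split=> [|i]; last by rewrite mxE eqxx dvdz_mulr.
  by apply/matrixP => i k; rewrite !mxE eq_sym; case: eqP => [->//|_]; rewrite addrC.
apply/matrixP => i k; rewrite !mxE; case: eqP => [->|_].
  by rewrite mulrCA [M * _]mulrC divzK // mulr2n mulrDl mul1r.
by rewrite mulrC divzK.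
Qed.

(** Orthogonality of characters: translation by a symmetric [W] on which the character is nontrivial
    multiplies the sum by a number other than 1, so the sum vanishes. *)
Lemma sum_mod_char V :
  \sum_(X | symmetric_mx (rep X)) psi (\tr (V *m rep X)) =
  if `[< mod_annihilates V >] then #|[pred X | symmetric_mx (rep X)]|%:R else 0.
Proof.
case: asboolP => [aV|naV].
  rewrite -sum1_card natr_sum; apply: eq_bigr => X sX.
  by apply/eqP; rewrite mod_char_eq1 aV.
have [W [sW nW]] : exists W, symmetric_mx W /\ ~ (M %| \tr (V *m W))%Z.
  apply: contrapT => H; apply: naV => W sW; apply: contrapT => nW.
  by apply: H; exists W.
set S := \sum_(_ | _) _.
have : psi (\tr (V *m W)) * S = S.
  transitivity (\sum_(X | symmetric_mx (rep X)) psi (\tr (V *m (rep X + W)))).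
    rewrite mulr_sumr; apply: eq_bigr => X _.
    by rewrite mulmxDr linearD mod_charD mulrC.
  apply: (@sum_reindex_mod n m _ symmetric_mx (fun X => X + W) (fun X => X - W)
    (fun X => psi (\tr (V *m X)))).
  - exact: mx_rep_red_sym.
  - by move=> U /eqP sU; rewrite /symmetric_mx linearD /= sU (eqP sW).
  - by move=> U U' [Q ->]; exists Q; rewrite addrAC.
  - by move=> U _; rewrite addrK; exact: mx_cong_refl.
  - move=> U U' _ _ UU'; apply: mod_char_tr_cong.
    by apply: mx_cong_mul => //; exact: mx_cong_refl.
move/eqP; rewrite -subr_eq0 -{2}[S]mul1r -mulrBl mulf_eq0 subr_eq0 mod_char_eq1.
by case/orP => [/nW|/eqP].
Qed.

(* [U] encodes the half-integral matrix T = (U + U^T)/2, so that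
   tr(TW) = tr(UW) for symmetric [W]. *)
Definition minors_cond U : Prop := minors_divide j M (U + U^T).

Lemma even_sym_double V : even_sym (V + V^T).
Proof.
split=> [|i]; first by rewrite linearD /= trmxK addrC.
by rewrite !mxE -[V i i]mul1r -mulrDl dvdz_mulr.
Qed.

Lemma minors_divide_iff (Y Y' Z : 'M[int]_n) : even_sym Y -> even_sym Z -> Y' = Y + M *: Z ->
  minors_divide j M Y <-> minors_divide j M Y'.
Proof.
move=> eY [sZ dZ] ->; split; first exact: minors_divide_shift.
move=> H; rewrite -(addrK (M *: Z) Y) -scalerN.
apply: minors_divide_shift => //.
  split=> [|i]; first by rewrite linearD linearZ /= sZ; case: eY => ->.
  by rewrite !mxE rpredD ?dvdz_mull //; case: eY.
by split=> [|i]; rewrite ?linearN /= ?sZ // mxE rpredN.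
Qed.

Lemma minors_cond_cong U V : mx_cong m U V -> minors_cond U <-> minors_cond V.
Proof.
move=> [W ->]; symmetry.
apply: (@minors_divide_iff _ _ (W + W^T)); try exact: even_sym_double.
by rewrite linearD linearZ /= scalerDr addrACA.
Qed.

Lemma minors_cond_annihilates U V :
  mod_annihilates (U - V) -> minors_cond U <-> minors_cond V.
Proof.
move=> /mod_annihilates_even[Y eY E]; symmetry.
apply: (minors_divide_iff (even_sym_double V) eY).
by rewrite -E linearB /= addrACA !subrKC.
Qed.

(* Finite Fourier transform of the indicator of [minors_cond]; the sum over all
   U modulo M counts every T modulo M equally often. *)
Definition fourier_weight W : C :=
  \sum_(X : 'M['I_m.+1]_n)
    if `[< minors_cond (rep X) >] then psi (- \tr (rep X *m W)) else 0.

Lemma fourier_weight_cong U V : mx_cong m U V ->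
  fourier_weight U = fourier_weight V.
Proof.
move=> UV; apply: eq_bigr => X _; case: ifP => // _.
by apply/mod_char_trN_cong/mx_cong_mul => //; exact: mx_cong_refl.
Qed.

(** After exchanging the sums, orthogonality keeps only the residues that differ from [U] by an
    annihilating matrix, and on these the condition agrees with that on [U]. The constant is
    [a * b], with [a] the number of symmetric residues and [b] the number of annihilating ones; both
    count 0. *)
Lemma fourier_inversion : exists2 K : C, K != 0 & forall U,
  \sum_(X | symmetric_mx (rep X)) fourier_weight (rep X) * psi (\tr (U *m rep X)) =
  if `[< minors_cond U >] then K else 0.
Proof.
pose a : C := #|[pred X | symmetric_mx (rep X)]|%:R.
pose b : C := \sum_X if `[< mod_annihilates (rep X) >] then 1 else 0.
have rep0 : rep 0 = 0 by apply/matrixP => i k; rewrite !mxE.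
have a0 : a != 0.
  rewrite pnatr_eq0 -lt0n; apply/card_gt0P; exists 0.
  by rewrite inE /symmetric_mx rep0 trmx0.
have b0 : b != 0.
  rewrite gt_eqF // /b (bigD1 0) //= rep0; case: asboolP => [_|[]]; last first.
    by move=> W _; rewrite mul0mx mxtrace0.
  by rewrite ltr_wpDr // sumr_ge0 // => X _; case: ifP.
exists (a * b); first by rewrite mulf_neq0.
move=> U; under eq_bigr => X _ do rewrite mulr_suml.
rewrite exchange_big /=.
(* The involution [X |-> U - X] shows that this count does not depend on [U]. *)
have bE : \sum_X (if `[< mod_annihilates (U - rep X) >] then 1 else 0 : C) = b.
  apply: (@sum_reindex_mod_all n m _ (fun X => U - X) (fun X => U - X)
    (fun X => if `[< mod_annihilates X >] then 1 else 0)).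
  - by move=> V V' [Q ->]; exists (- Q); rewrite opprD addrA scalerN.
  - by move=> V; rewrite subKr; exact: mx_cong_refl.
  - by move=> V V' /mod_annihilates_cong/asbool_equiv_eq ->.
transitivity (\sum_X (if `[< minors_cond U >] then a else 0) *
    (if `[< mod_annihilates (U - rep X) >] then 1 else 0) : C).
  apply: eq_bigr => Y _.
  transitivity ((if `[< minors_cond (rep Y) >] then 1 else 0) *
      \sum_(X | symmetric_mx (rep X)) psi (\tr ((U - rep Y) *m rep X))).
    rewrite mulr_sumr; apply: eq_bigr => X _; rewrite mulmxBl linearB /= mod_charD.
    by case: ifP => _; rewrite ?mul0r // mul1r mulrC.
  rewrite sum_mod_char; case: (asboolP (mod_annihilates _)) => [an|_]; last by rewrite !mulr0.
  rewrite (asbool_equiv_eq (minors_cond_annihilates an)).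
  by case: ifP => _; rewrite ?mul0r // mul1r mulr1.
by rewrite -mulr_sumr bE; case: ifP => _; rewrite ?mul0r.
Qed.

Lemma minors_cond_congruence (A V : 'M[int]_n) :
  minors_cond V -> minors_cond (A^T *m V *m A).
Proof.
move=> cV; rewrite /minors_cond.
have -> : A^T *m V *m A + (A^T *m V *m A)^T = A^T *m (V + V^T) *m A.
  by rewrite !trmx_mul trmxK mulmxDr mulmxDl mulmxA.
by apply: minors_divide_congruence => //; case: (even_sym_double V).
Qed.

(* tr(U D^T W D) = tr(D U D^T W), and U -> D U D^T permutes the U mod M. *)
Lemma fourier_weight_congruence (A D W : 'M[int]_n) : mx_cong m (A^T *m D) 1%:M ->
  fourier_weight (D^T *m W *m D) = fourier_weight W.
Proof.
move=> AD.
have ADA V : mx_cong m (A^T *m (D *m V *m D^T) *m A) V.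
  have -> : A^T *m (D *m V *m D^T) *m A = (A^T *m D) *m V *m (A^T *m D)^T.
    by rewrite trmx_mul trmxK !mulmxA.
  have /mx_cong_mul := mx_cong_mul AD (mx_cong_refl m V).
  by move=> /(_ _ _ (mx_cong_tr AD)); rewrite trmx1 mulmx1 mul1mx.
pose f V := if `[< minors_cond V >] then psi (- \tr (V *m W)) else 0 : C.
have fc U V : mx_cong m U V -> f U = f V.
  move=> UV; rewrite /f (asbool_equiv_eq (minors_cond_cong UV)); case: ifP => // _.
  by apply/mod_char_trN_cong/mx_cong_mul => //; exact: mx_cong_refl.
rewrite -[RHS]/(\sum_X f (rep X)).
rewrite -(@sum_reindex_mod_all n m _ (fun V => D *m V *m D^T)
   (fun V => A^T *m V *m A) f _ ADA fc) => [|U V UV]; last first.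
  by apply: mx_cong_mul (mx_cong_refl m _); apply: mx_cong_mul (mx_cong_refl m _) _.
apply: eq_bigr => X _; rewrite /f.
(* Congruence by [D^T] gives one direction; congruence by [A] undoes it modulo M and gives the
   other. *)
have -> : `[< minors_cond (D *m rep X *m D^T) >] = `[< minors_cond (rep X) >].
  apply: asbool_equiv_eq; split; last first.
    by rewrite -[X in _ -> minors_cond (X *m _ *m _)]trmxK; exact: minors_cond_congruence.
  by move=> /(minors_cond_congruence A); rewrite (minors_cond_cong (ADA _)).
case: ifP => // _; congr (psi (- _)).
by rewrite !mulmxA mxtrace_mulC !mulmxA.
Qed.

End FiniteInversion.

(** * Symplectic matrices *)

Section SymplecticBlocks.
Variable n : nat.

Lemma SpP (A B C D : 'M[int]_n) : Sp n (block_mx A B C D) <->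
  [/\ A^T *m C = C^T *m A, B^T *m D = D^T *m B & A^T *m D - C^T *m B = 1%:M].
Proof.
have -> : Sp n (block_mx A B C D) <->
    block_mx (A^T *m C - C^T *m A) (A^T *m D - C^T *m B)
             (B^T *m C - D^T *m A) (B^T *m D - D^T *m B) =
    block_mx 0 1%:M (- 1%:M) 0.
  rewrite /Sp /= /symplectic_form tr_block_mx !mulmx_block.
  rewrite !mulmx0 !mulmx1 !mulmxN !mulmx1 !add0r !addr0 !mulNmx.
  rewrite ![- (_^T *m _) + _]addrC.
  by [].
split=> [/eq_block_mx[/eqP AC AD _ /eqP BD]|[AC BD AD]].
  by move: AC BD; rewrite !subr_eq0 => /eqP AC /eqP BD.
rewrite AC BD AD !subrr; congr block_mx.
by rewrite -[in LHS](opprB) -[D^T *m A]trmxK -[B^T *m C]trmxK -linearB /= !trmx_mul !trmxK AD trmx1.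
Qed.

(** The relations of [SpP] exhibit a left inverse of the block matrix. It is also a right inverse,
    and the upper left block of that product is the claim. *)
Lemma Sp_tr (A B C D : 'M[int]_n) : Sp n (block_mx A B C D) ->
  A *m D^T - B *m C^T = 1%:M.
Proof.
move=> /SpP[AC BD AD].
have E : block_mx D^T (- B^T) (- C^T) A^T *m block_mx A B C D = 1%:M.
  rewrite mulmx_block !mulNmx AC BD ![- _ + _]addrC !subrr AD.
  have -> : D^T *m A - B^T *m C = 1%:M.
    by rewrite -[RHS]trmx1 -AD linearB /= !trmx_mul !trmxK.
  by rewrite -scalar_mx_block.
move: E => /mulmx1C; rewrite mulmx_block scalar_mx_block => /eq_block_mx[+ _ _ _].
by rewrite mulmxN.
Qed.

End SymplecticBlocks.

Section Twist.
Variable n : nat.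

(* Top row of t(x/mu) g = g' t(x'/mu), applied to z; for z = - x'/mu it is the
   top right block of g'. *)
Lemma twist_numerator (K : fieldType) (s mu nu : K) (a b c c0 d x z : 'M[K]_n) :
  s * mu = 1 -> c = (nu * mu ^+ 2) *: c0 -> a *m d^T - b *m c^T = 1%:M ->
  let x' := d^T *m x *m d in
  (a + (nu * mu) *: (x *m c0)) *m (z + s *: x') +
    (b - (nu * mu) *: (b *m c0^T *m x *m d) - nu *: (x *m c0 *m x')) =
  (a *m z + b) + s *: x *m (c *m z + d).
Proof.
move=> smu cE E x'.
(* Inserting 1 = a d^T - b c^T in front of x turns x d into a x' up to a multiple of mu^2, so
   dividing by mu leaves no denominator. *)
have xd : x *m d = a *m x' - (nu * mu ^+ 2) *: (b *m c0^T *m x *m d).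
  rewrite -[in LHS](mul1mx x) -E mulmxBl mulmxBl cE /x' linearZ /=.
  by rewrite -scalemxAr -!scalemxAl !mulmxA.
clearbody x'.
rewrite [RHS]addrC mulmxDr -[s *: x *m d]scalemxAl xd cE.
rewrite -!scalemxAl -!scalemxAr !mulmxDl !mulmxDr -!scalemxAl -!scalemxAr !mulmxA.
move: (a *m z) (a *m x') (x *m c0 *m z) (x *m c0 *m x') (b *m c0^T *m x *m d).
move=> az ax' xcz xcx' bcxd; apply/matrixP => i k; rewrite !mxE.
have s0 : s != 0 by apply: contra_eq_neq smu => ->; rewrite mul0r eq_sym oner_neq0.
have -> : mu = s^-1 by apply: (mulfI s0); rewrite smu divff.
by field.
Qed.

Variables (m N : nat).
Local Notation M := (m.+1%:Z).

(* The matrix g' with t(X/M) g = g' t(X'/M), where X' = D^T X D and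
   g = (A B; C D), C = N M^2 C0. *)
Definition twist (A B C0 D X : 'M[int]_n) : 'M[int]_(n + n) :=
  let X' := D^T *m X *m D in
  block_mx (A + (N%:Z * M) *: (X *m C0))
    (B - (N%:Z * M) *: (B *m C0^T *m X *m D) - N%:Z *: (X *m C0 *m X'))
    ((N%:Z * M ^+ 2) *: C0)
    (D - (N%:Z * M) *: (C0 *m X')).

(** Over the rationals the matrix is the product t(X/M) g t(-X'/M) of three matrices preserving the
    symplectic form; the resulting identity between integral matrices descends by injectivity of the
    embedding. *)
Lemma twist_Sp (A B C0 D X : 'M[int]_n) : X^T = X ->
  Sp n (block_mx A B ((N%:Z * M ^+ 2) *: C0) D) -> Sp n (twist A B C0 D X).
Proof.
move=> sX gSp; set C := _ *: C0 in gSp; set X' := D^T *m X *m D.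
have sX' : X'^T = X' by rewrite /X' !trmx_mul trmxK sX mulmxA.
pose q p r : 'M[int]_(p, r) -> 'M[rat]_(p, r) := map_mx intr.
pose s : rat := M%:~R^-1.
have sM : s * M%:~R = 1 by rewrite mulVf // intr_eq0.
pose t (S : 'M[rat]_n) := block_mx 1%:M S 0 1%:M.
pose J : 'M[rat]_(n + n) := block_mx 0 1%:M (- 1%:M) 0.
have tJ S : S^T = S -> (t S)^T *m J *m t S = J.
  move=> sS; rewrite /t /J tr_block_mx !mulmx_block trmx0 !trmx1 sS.
  rewrite !mul0mx !mulmx0 !mul1mx !mulmx1 !addr0 !add0r mulNmx mul1mx.
  by rewrite addNr mul0mx add0r.
have jE : map_mx (intr : int -> rat) (symplectic_form n) = J.
  by rewrite /symplectic_form map_block_mx map_mx0 map_mxN map_mx1.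
have E : q (n + n)%N (n + n)%N (twist A B C0 D X) =
    t (s *: q _ _ X) *m q _ _ (block_mx A B C D) *m t (- (s *: q _ _ X')).
  rewrite /q /t !map_block_mx !mulmx_block !mul1mx !mul0mx !mulmx1 !mulmx0 !addr0 !add0r.
  have ABC : q _ _ A *m (q _ _ D)^T - q _ _ B *m (q _ _ C)^T = 1%:M.
    by rewrite /q !map_trmx -!map_mxM -map_mxB (Sp_tr gSp) map_mx1.
  have CE : q _ _ C = (N%:~R * M%:~R ^+ 2) *: q _ _ C0.
    by rewrite /q map_mxZ rmorphM rmorphXn.
  have X'E : q _ _ X' = (q _ _ D)^T *m q _ _ X *m q _ _ D.
    by rewrite /q map_trmx -!map_mxM.
  have NM : s * (N%:~R * M%:~R ^+ 2) = N%:~R * M%:~R.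
    by rewrite mulrCA expr2 [s * _]mulrA sM mul1r.
  congr block_mx.
  - by rewrite map_mxD map_mxZ map_mxM rmorphM -/(q _ _ C) CE -scalemxAl -scalemxAr scalerA NM.
  - have := @twist_numerator _ s M%:~R N%:~R _ _ _ _ _ (q _ _ X) (- (s *: q _ _ X')) sM CE ABC.
    move=> /=; rewrite -X'E addNr mulmx0 add0r => E.
    apply: (etrans _ (etrans E _)).
      by rewrite -/X' /q !map_mxB !map_mxZ !map_mxM rmorphM /= map_trmx.
    by rewrite mulmxDr mulmxA mulmxDl addrACA.
  - by rewrite -/X' map_mxB map_mxZ map_mxM rmorphM -/(q _ _ C) CE -scalemxAl mulmxN -scalemxAr
      scalerN scalerA [_ * s]mulrC NM addrC.
rewrite /Sp /=.
have : q _ _ ((twist A B C0 D X)^T *m symplectic_form n *m twist A B C0 D X) =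
    q _ _ (symplectic_form n).
  have tT S : (t S)^T = block_mx 1%:M 0 S^T 1%:M.
    by rewrite /t tr_block_mx trmx0 !trmx1.
  rewrite {1}/q !map_mxM -map_trmx -/(q _ _ _) E {2}/q jE !trmx_mul.
  have gJ : (q _ _ (block_mx A B C D))^T *m J *m q _ _ (block_mx A B C D) = J.
    by rewrite -jE /q map_trmx -!map_mxM gSp.
  rewrite !mulmxA -[_ *m J *m _]mulmxA.
  transitivity ((t (- (s *: q _ _ X')))^T *m ((q _ _ (block_mx A B C D))^T *m
    ((t (s *: q _ _ X))^T *m J *m t (s *: q _ _ X)) *m q _ _ (block_mx A B C D)) *m
    t (- (s *: q _ _ X'))); first by rewrite !mulmxA.
  rewrite tJ; last by rewrite linearZ /= /q map_trmx sX.
  rewrite gJ tJ; last by rewrite linearN linearZ /= /q map_trmx sX'.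
  by rewrite /q jE.
move/matrixP => H; apply/matrixP => i k; apply: (@intr_inj rat).
by have := H i k; rewrite !mxE.
Qed.

End Twist.

(** * The Siegel upper half space *)

Section SiegelSpace.
Variables (R : realType) (n : nat).
Local Notation C := R[i].
Local Notation cplx := (map_mx (real_complex R)).
Local Notation Im := (map_mx (@complex.Im R)).
Implicit Types (Z : 'M[C]_n).

Local Notation conj := (map_mx (@conjc R)).

Lemma siegel_space_shift Z (S : 'M[C]_n) : S^T = S -> Im S = 0 ->
  siegel_space Z -> siegel_space (Z + S).
Proof.
move=> sS iS [sZ pZ]; split; first by rewrite linearD /= sZ sS.
have -> : Im (Z + S) = Im Z; last by [].
apply/matrixP => i k; rewrite !mxE raddfD /=.
by move/matrixP/(_ i k): iS; rewrite !mxE => ->; rewrite addr0.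
Qed.

Lemma mx_ReIm m p (v : 'M[C]_(m, p)) :
  v = cplx (map_mx (@complex.Re R) v) + 'i%C *: cplx (Im v).
Proof.
apply/matrixP => i k; rewrite !mxE; case: (v i k) => a b.
by apply/eqP; rewrite eq_complex /= !mul0r !mul1r !subr0 !addr0 ?add0r !eqxx.
Qed.

Lemma double_i_neq0 : 2 * 'i%C != 0 :> C.
Proof. by rewrite mulf_neq0 ?pnatr_eq0 // eq_complex /= oner_eq0 andbF. Qed.

Lemma sub_conj_mx Z : Z - conj Z = (2 * 'i%C) *: cplx (Im Z).
Proof.
apply/matrixP => i k; rewrite !mxE; case: (Z i k) => a b.
apply/eqP; rewrite eq_complex /=; apply/andP; split; apply/eqP; ring.
Qed.

(** With v = x + iy the cross terms cancel by symmetry of Im Z, leaving 2i times the sum of the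
    values of Im Z at x and y. The form is written with [Z - conj Z] to match [num_den_sub]. *)
Lemma herm_form_pos Z (v : 'cV[C]_n) : siegel_space Z -> v != 0 ->
  exists2 r : R, 0 < r &
    ((conj v)^T *m (Z - conj Z) *m v) 0 0 = (2 * 'i%C) * r%:C.
Proof.
move=> [sZ pZ] v0; rewrite sub_conj_mx -scalemxAr -scalemxAl mxE.
set Y := Im Z.
have sY : Y^T = Y by rewrite /Y map_trmx sZ.
set x := map_mx (@complex.Re R) v; set y := Im v.
have vE : v = cplx x + 'i%C *: cplx y by exact: mx_ReIm.
have cvE : conj v = cplx x - 'i%C *: cplx y.
  apply/matrixP => i k; rewrite !mxE; case: (v i k) => a b.
  apply/eqP; rewrite eq_complex /=; apply/andP; split; apply/eqP; ring.
pose q (u w : 'cV[R]_n) : R := (u^T *m Y *m w) 0 0.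
have qC u w : ((cplx u)^T *m cplx Y *m cplx w) 0 0 = (q u w)%:C.
  by rewrite map_trmx -!map_mxM mxE.
have qsym u w : q u w = q w u.
  rewrite /q; transitivity ((u^T *m Y *m w)^T 0 0); first by rewrite [RHS]mxE.
  by rewrite !trmx_mul trmxK sY mulmxA.
have qpos u : 0 <= q u u.
  have [->|/pZ/ltW//] := eqVneq u 0.
  by rewrite /q mulmx0 mxE.
exists (q x x + q y y).
  have [x0|x0] := eqVneq x 0; last by rewrite ltr_wpDr // pZ.
  have y0 : y != 0.
    by apply: contra v0 => /eqP y0; rewrite vE x0 y0 !map_mx0 scaler0 addr0.
  by rewrite ltr_wpDl // pZ.
congr (_ * _).
transitivity ((((cplx x)^T - 'i%C *: (cplx y)^T) *m cplx Y *m (cplx x + 'i%C *: cplx y)) 0 0).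
  by rewrite cvE -vE linearB linearZ.
have ii : 'i%C * 'i%C = -1 :> C by rewrite -expr2 sqr_i.
transitivity ((q x x)%:C + 'i%C * (q x y)%:C - ('i%C * (q y x)%:C + 'i%C * 'i%C * (q y y)%:C)).
  rewrite -!qC; move: (cplx x)^T (cplx y)^T (cplx x) (cplx y) (cplx Y) => a b c d e.
  rewrite !mulmxBl !mulmxDr -!scalemxAl -!scalemxAr.
  move: (a *m e *m c) (a *m e *m d) (b *m e *m c) (b *m e *m d) => m1 m2 m3 m4.
  by rewrite !mxE; ring.
by rewrite (qsym y x) ii rmorphD /=; ring.
Qed.

Variable g : 'M[int]_(n + n).
Hypothesis gSp : Sp n g.
Local Notation cint := (map_mx (intr : int -> C)).
Local Notation A := (cint (ulsubmx g)).
Local Notation B := (cint (ursubmx g)).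
Local Notation Ci := (cint (dlsubmx g)).
Local Notation D := (cint (drsubmx g)).

Lemma Sp_complex : [/\ A^T *m Ci = Ci^T *m A, B^T *m D = D^T *m B
  & A^T *m D - Ci^T *m B = 1%:M].
Proof.
have /SpP[AC BD AD] : Sp n (block_mx (ulsubmx g) (ursubmx g) (dlsubmx g) (drsubmx g)).
  by rewrite submxK.
by rewrite !map_trmx -!map_mxM AC BD -map_mxB AD map_mx1.
Qed.

Let num Z := A *m Z + B.
Let den Z := automorphy g Z.

Lemma conj_cint p r (U : 'M[int]_(p, r)) : conj (cint U) = cint U.
Proof. by apply/matrixP => i k; rewrite !mxE rmorph_int. Qed.

(** One identity serves two purposes: Z' = Z gives the symmetry of [moebius g Z], and Z' = conj Z
    compares imaginary parts. *)
Lemma num_den_sub Z Z' : Z'^T = Z' ->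
  (den Z')^T *m num Z - (num Z')^T *m den Z = Z - Z'.
Proof.
have [AC BD AD] := Sp_complex => sZ'.
have DA : D^T *m A - B^T *m Ci = 1%:M.
  by rewrite -[RHS]trmx1 -AD linearB /= !trmx_mul !trmxK.
rewrite /den /num /automorphy !linearD /= !trmx_mul sZ'.
move: A B Ci D AC BD AD DA => a b c d AC BD AD DA.
rewrite !mulmxDl !mulmxA.
rewrite -[in RHS](mul1mx Z) -DA -[in RHS](mulmx1 Z') -AD !mulmxBl mulmxBr !mulmxA.
rewrite -[Z' *m c^T *m a]mulmxA -AC -[d^T *m b]BD !mulmxA.
apply/matrixP => i k; rewrite !mxE; ring.
Qed.

Lemma num_den_sym Z : Z^T = Z -> (den Z)^T *m num Z = (num Z)^T *m den Z.
Proof. by move=> sZ; apply/eqP; rewrite -subr_eq0 num_den_sub // subrr. Qed.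

(** By [num_den_sub] at conj Z, a vector killed by CZ + D would be a zero of the Hermitian form of
    [herm_form_pos]. *)
Lemma automorphy_unit Z : siegel_space Z -> automorphy g Z \in unitmx.
Proof.
move=> hZ; have [sZ _] := hZ; rewrite -unitmx_tr -row_free_unit -kermx_eq0.
apply/negPn/negP => /rowV0Pn[v /sub_kermxP vk v0].
have dv : den Z *m v^T = 0 by rewrite -[LHS]trmxK trmx_mul trmxK vk trmx0.
have [|r r0] := @herm_form_pos Z v^T hZ; first by rewrite trmx_eq0.
rewrite -num_den_sub; last by rewrite map_trmx sZ.
rewrite mulmxBr mulmxBl -!mulmxA dv !mulmx0 subr0 !mulmxA -trmx_mul.
have -> : den (conj Z) = conj (den Z).
  by rewrite /den /automorphy map_mxD map_mxM !conj_cint.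
rewrite -map_mxM dv map_mx0 trmx0 !mul0mx mxE => /esym/eqP.
by rewrite mulf_eq0 (negbTE double_i_neq0) /= fmorph_eq0 gt_eqF.
Qed.

Lemma moebius_siegel_space Z : siegel_space Z -> siegel_space (moebius g Z).
Proof.
move=> hZ; have [sZ _] := hZ; have uQ := automorphy_unit hZ.
have uQT : (den Z)^T \in unitmx by rewrite unitmx_tr.
pose W := moebius g Z.
have WQ : W *m den Z = num Z by rewrite /W /moebius mulmxKV.
have sW : W^T = W.
  apply: (can_inj (mulKmx uQT)); apply: (can_inj (mulmxK uQ)).
  by rewrite -[_^T *m W^T]trmx_mul WQ -mulmxA WQ num_den_sym.
split=> // v v0; rewrite -/W; clearbody W.
have [r r0 Er] : exists2 r : R, 0 < r &
    ((cplx v)^T *m (W - conj W) *m cplx v) 0 0 = (2 * 'i%C) * r%:C.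
  (* The Hermitian form of the image point at v equals that of Z at u = (CZ + D)^-1 v, so positivity
     is inherited. *)
  pose u := invmx (den Z) *m cplx v.
  have uE : den Z *m u = cplx v by rewrite mulKVmx.
  have u0 : u != 0.
    apply: contra v0 => /eqP u0; rewrite -(map_mx_eq0 (real_complex R)) -uE u0.
    by rewrite mulmx0.
  have [r r0 Er] := herm_form_pos hZ u0; exists r => //; rewrite -{}Er.
  clearbody u.
  have numu : num Z *m u = W *m cplx v by rewrite -WQ -mulmxA uE.
  have cden : den (conj Z) = conj (den Z).
    by rewrite /den /automorphy map_mxD map_mxM !conj_cint.
  have cnum : num (conj Z) = conj (num Z).
    by rewrite /num map_mxD map_mxM !conj_cint.
  have cv : conj (cplx v) = cplx v.
    by apply/matrixP => i k; rewrite !mxE /= oppr0.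
  rewrite -[Z - conj Z]num_den_sub; last by rewrite map_trmx sZ.
  rewrite cden cnum !mulmxBr !mulmxBl.
  congr (fun_of_matrix _ 0 0); congr (_ - _).
    by rewrite mulmxA -trmx_mul -map_mxM uE cv -!mulmxA numu.
  by rewrite -[in RHS]mulmxA -[_ *m den Z *m u]mulmxA uE mulmxA -trmx_mul -map_mxM numu
    map_mxM cv trmx_mul [(conj W)^T]map_trmx sW.
move: Er; rewrite sub_conj_mx -scalemxAr -scalemxAl mxE map_trmx -!map_mxM mxE.
by move/(mulfI double_i_neq0)/(fmorph_inj (real_complex R)) => ->.
Qed.

End SiegelSpace.

(** * Openness of the Siegel space and stability of holomorphy *)

Section SiegelOpen.
Local Open Scope classical_set_scope.
Variables (R : realType).
Local Notation C := R[i].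
Local Notation Im := (map_mx (@complex.Im R)).

Lemma normc_ge_absIm (z : C) : `|complex.Im z|%:C <= `|z|.
Proof. by rewrite normc_def lecR -sqrtr_sqr ler_wsqrtr // lerDr sqr_ge0. Qed.

Lemma continuous_sum (T : topologicalType) (K : numFieldType) (V : normedModType K)
    (I : Type) (r : seq I) (f : I -> T -> V) :
  (forall i, continuous (f i)) -> continuous (fun x => \sum_(i <- r) f i x).
Proof.
move=> cf x; elim: r => [|i r IH].
  have -> : (fun y => \sum_(i <- [::]) f i y) = cst 0.
    by apply/funext => y; rewrite big_nil.
  exact: cst_continuous.
have -> : (fun y => \sum_(k <- i :: r) f k y) = f i \+ (fun y => \sum_(k <- r) f k y).
  by apply/funext => y; rewrite big_cons.
by apply: continuousD => //; exact: cf.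
Qed.

Lemma ler_norm_mx_entry (K : numDomainType) m n (A : 'M[K]_(m, n)) i k :
  `|A i k| <= `|A|.
Proof.
rewrite [leRHS]/Num.norm /= mx_normE -[leLHS]nngE num_le.
exact: (le_bigmax _ (fun ik : 'I_m * 'I_n => `|A ik.1 ik.2|%:nng) (i, k)).
Qed.

(** On the compact unit sphere of the maximum norm the form attains a positive minimum [f c]; by
    homogeneity it is at least [f c] times the squared norm everywhere. *)
Lemma posdef_open n (Y : 'M[R]_n) : posdef Y ->
  exists2 d : R, 0 < d & forall H : 'M[R]_n, (forall i k, `|H i k| < d) -> posdef (Y + H).
Proof.
case: n Y => [|n] Y pY.
  by exists 1 => // H _ v; rewrite [v]flatmx0 eqxx.
have qE (W : 'M[R]_n.+1) (v : 'cV[R]_n.+1) :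
    (v^T *m W *m v) 0 0 = \sum_i \sum_k v i 0 * W i k * v k 0.
  rewrite -mulmxA mxE; apply: eq_bigr => i _; rewrite !mxE mulr_sumr.
  by apply: eq_bigr => k _; rewrite mulrA.
pose S := [set v : 'rV[R]_n.+1 | `|v| = 1].
pose f (v : 'rV[R]_n.+1) := (v *m Y *m v^T) 0 0.
have cf : continuous f.
  have -> : f = fun v => \sum_i \sum_k v 0 i * Y i k * v 0 k.
    apply/funext => v; rewrite /f -[X in X *m Y]trmxK qE.
    by apply: eq_bigr => i _; apply: eq_bigr => k _; rewrite !mxE.
  apply: continuous_sum => i; apply: continuous_sum => k v.
  apply: (@continuousM _ _ (fun w : 'rV[R]_n.+1 => w 0 i * Y i k) (fun w => w 0 k));
    last exact: coord_continuous.
  apply: (@continuousM _ _ (fun w : 'rV[R]_n.+1 => w 0 i) (cst (Y i k)));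
    [exact: coord_continuous|exact: cst_continuous].
have cS : compact S.
  apply: bounded_closed_compact.
    by exists 1; split => // x x1 v /= ->; exact: ltW.
  have -> : S = (fun v : 'rV[R]_n.+1 => `|v|) @^-1` [set 1] by [].
  apply: preimage_closed; last exact: closed_eq.
  by move=> v _; exact: norm_continuous.
have S0 : S !=set0.
  pose v : 'rV[R]_n.+1 := const_mx 1; exists (`|v|^-1 *: v).
  have v0 : v != 0.
    by apply/eqP => /matrixP/(_ 0 0); rewrite !mxE; apply/eqP; exact: oner_neq0.
  by rewrite /S /= normrZ normfV normr_id mulVf // normr_eq0.
have [c cinS cmin] := compact_EVT_min S0 cS (continuous_subspaceT cf).
have c0 : 0 < f c.
  have := pY c^T; rewrite /f trmxK; apply.
  rewrite trmx_eq0; apply/negP => /eqP c0; move: cinS; rewrite inE /S /= c0 normr0.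
  by move/esym/eqP; rewrite oner_eq0.
pose N : R := n.+1%:R.
have N0 : 0 < N by rewrite ltr0n.
(* The perturbation contributes N^2 terms, each at most this radius times the squared norm, hence at
   most half of the lower bound. *)
exists (f c / (2 * N * N)); first by rewrite divr_gt0 // !mulr_gt0.
move=> H hH v v0.
pose a := `|v^T|.
have a0 : 0 < a by rewrite normr_gt0 trmx_eq0.
have va i : `|v i 0| <= a.
  by have := ler_norm_mx_entry v^T 0 i; rewrite mxE.
have fv : f c * a ^+ 2 <= (v^T *m Y *m v) 0 0.
  have := cmin (a^-1 *: v^T); rewrite inE /S /= normrZ normfV normr_id mulVf ?gt_eqF //.
  move=> /(_ erefl); rewrite /f linearZ /= trmxK -!scalemxAl -scalemxAr scalerA mxE.
  rewrite -ler_pdivlMr ?exprn_gt0 // => /le_trans; apply.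
  by rewrite mxE [leRHS]mulrC expr2 invfM.
have Hv : `|(v^T *m H *m v) 0 0| < f c * a ^+ 2.
  rewrite qE; apply: le_lt_trans (ler_norm_sum _ _ _) _.
  apply: (@le_lt_trans _ _ (\sum_(i < n.+1) \sum_(k < n.+1) a * (f c / (2 * N * N)) * a)).
    apply: ler_sum => i _; apply: le_trans (ler_norm_sum _ _ _) _.
    apply: ler_sum => k _; rewrite !normrM.
    by rewrite !ler_pM ?mulr_ge0 // ltW.
  have sumC (x : R) : \sum_(i < n.+1) x = N * x.
    by rewrite sumr_const card_ord mulr_natl.
  have -> : \sum_(i < n.+1) \sum_(k < n.+1) a * (f c / (2 * N * N)) * a =
      f c * a ^+ 2 / 2.
    rewrite !sumC.
    by field; rewrite gt_eqF.
  have : 0 < f c * a ^+ 2 by rewrite mulr_gt0 ?exprn_gt0.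
  by lra.
rewrite mulmxDr mulmxDl mxE -ltrBlDr sub0r.
apply: lt_le_trans fv; apply: le_lt_trans Hv.
by rewrite -normrN ler_norm.
Qed.

Variable n : nat.
Implicit Types (Z H : 'M[C]_n) (F : 'M[C]_n -> C).

Lemma siegel_space_near Z : siegel_space Z ->
  \forall H \near within [set H | H^T = H] (nbhs (0 : 'M[C]_n)), siegel_space (Z + H).
Proof.
move=> [sZ /posdef_open[d d0 Hd]]; apply/nbhs_ballP; exists d%:C => /=.
  by rewrite ltcR.
move=> H [_ bH] /= sH; split; first by rewrite linearD /= sZ sH.
have -> : Im (Z + H) = Im Z + Im H by apply/matrixP => i k; rewrite !mxE raddfD.
apply: Hd => i k; rewrite mxE -ltcR.
have := bH i k; rewrite -ball_normE /ball_ /= mxE sub0r normrN.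
by apply: le_lt_trans; exact: normc_ge_absIm.
Qed.

(** Agreement on the Siegel space suffices because [Z + H] stays inside it for small symmetric
    [H]. *)
Lemma siegel_holomorphic_eq F G :
  {in @siegel_space R n, F =1 G} -> siegel_holomorphic F -> siegel_holomorphic G.
Proof.
move=> FG hF Z hZ; have [L hL] := hF Z hZ; exists L => e e0.
near=> H.
rewrite -!FG ?inE //; last by near: H; exact: siegel_space_near.
by near: H; exact: hL.
Unshelve. all: end_near. Qed.

Lemma siegel_holomorphic0 : siegel_holomorphic (fun _ : 'M[C]_n => 0 : C).
Proof.
move=> Z hZ; exists (\0 : {linear 'M[C]_n -> C}) => e e0.
by near=> H; rewrite /= subrr subr0 normr0 mulr_ge0 // ltW.
Unshelve. all: end_near. Qed.

Lemma siegel_holomorphicD F G : siegel_holomorphic F -> siegel_holomorphic G ->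
  siegel_holomorphic (fun Z => F Z + G Z).
Proof.
move=> hF hG Z hZ; have [L hL] := hF Z hZ; have [K hK] := hG Z hZ.
exists (L \+ K : {linear 'M[C]_n -> C}) => e e0.
have e20 : 0 < e / 2 by rewrite divr_gt0.
near=> H.
have -> : F (Z + H) + G (Z + H) - (F Z + G Z) - (L H + K H) =
  (F (Z + H) - F Z - L H) + (G (Z + H) - G Z - K H) by ring.
apply: le_trans (ler_normD _ _) _; rewrite [e]splitr mulrDl lerD //.
  by near: H; exact: hL.
by near: H; exact: hK.
Unshelve. all: end_near. Qed.

Lemma siegel_holomorphicZ (c : C) F : siegel_holomorphic F ->
  siegel_holomorphic (fun Z => c * F Z).
Proof.
move=> hF Z hZ; have [L hL] := hF Z hZ.
exists (c \*: L : {linear 'M[C]_n -> C}) => e e0.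
have c0 : 0 < `|c| + 1 by rewrite ltr_wpDl.
have e'0 : 0 < e / (`|c| + 1) by rewrite divr_gt0.
near=> H.
have -> : c * F (Z + H) - c * F Z - c *: L H = c * (F (Z + H) - F Z - L H).
  by rewrite -[c *: L H]/(c * L H); ring.
rewrite normrM; apply: (@le_trans _ _ ((`|c| + 1) * (e / (`|c| + 1) * `|H|))).
  apply: ler_pM => //; first by rewrite lerDl.
  by near: H; exact: hL.
by rewrite mulrA mulrCA divff ?gt_eqF // mulr1.
Unshelve. all: end_near. Qed.

Lemma siegel_holomorphic_shift (S : 'M[C]_n) F : S^T = S -> Im S = 0 ->
  siegel_holomorphic F -> siegel_holomorphic (fun Z => F (Z + S)).
Proof.
move=> sS iS hF Z hZ; have [L hL] := hF _ (siegel_space_shift sS iS hZ).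
exists L => e e0; near=> H.
by rewrite [Z + H + S]addrAC; near: H; exact: hL.
Unshelve. all: end_near. Qed.

Lemma siegel_holomorphic_sum (I : Type) (r : seq I) (P : pred I)
    (F : I -> 'M[C]_n -> C) :
  (forall i, P i -> siegel_holomorphic (F i)) ->
  siegel_holomorphic (fun Z => \sum_(i <- r | P i) F i Z).
Proof.
move=> hF; elim: r => [|i r IH].
  have -> : (fun Z => \sum_(i <- [::] | P i) F i Z) = (fun=> 0).
    by apply/funext => Z; rewrite big_nil.
  exact: siegel_holomorphic0.
have [Pi|Pi] := boolP (P i).
  have -> : (fun Z => \sum_(k <- i :: r | P k) F k Z) =
      (fun Z => F i Z + \sum_(k <- r | P k) F k Z).
    by apply/funext => Z; rewrite big_cons Pi.
  by apply: siegel_holomorphicD => //; exact: hF.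
have -> : (fun Z => \sum_(k <- i :: r | P k) F k Z) =
    (fun Z => \sum_(k <- r | P k) F k Z) => //.
by apply/funext => Z; rewrite big_cons (negbTE Pi).
Qed.

End SiegelOpen.

(** * The sum of shifts *)

Section ShiftFormula.
#[local] Existing Instance totally_filter.
Local Open Scope classical_set_scope.
Variables (R : realType) (n m j : nat).
Local Notation C := R[i].
Local Notation M := (m.+1%:Z).
Local Notation psi := (@mod_char R m).
Local Notation rep := (@mx_rep n m).
Implicit Types (Z : 'M[C]_n) (U V X : 'M[int]_n) (T : 'M[rat]_n) (F : 'M[C]_n -> C).

Definition frac_mx X : 'M[C]_n := m.+1%:R^-1 *: map_mx intr X.

Lemma frac_mx_sym X : X^T = X -> (frac_mx X)^T = frac_mx X.
Proof. by move=> sX; rewrite /frac_mx linearZ /= map_trmx sX. Qed.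

Lemma frac_mx_Im X : map_mx (@complex.Im R) (frac_mx X) = 0.
Proof.
apply/matrixP => i k; rewrite !mxE.
have -> : m.+1%:R^-1 * (X i k)%:~R = (m.+1%:R^-1 * (X i k)%:~R : R)%:C :> C.
  by rewrite rmorphM /= fmorphV /= rmorph_nat rmorph_int.
by [].
Qed.

(** [U] is upper triangular with the [T i i] on the diagonal and the [2 * T i k] above it, all
    integers. *)
Lemma half_integral_symmetrize T : half_integral T ->
  exists U, T = 2^-1 *: map_mx intr (U + U^T).
Proof.
move=> [sT dT oT].
exists (\matrix_(i, k) if (i < k)%N then Num.floor (2 * T i k)
                       else if (i == k)%N then Num.floor (T i i) else 0).
apply/matrixP => i k; rewrite !mxE.
have T2 (x : rat) : x = 2^-1 * (2 * x) by rewrite mulKf.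
have [ik|ki|/val_inj ik] := ltngtP i k.
- rewrite -[k == i]/(val k == val i) (gtn_eqF ik) addr0 floorK ?oT //; exact: T2.
- rewrite -[i == k]/(val i == val k) (gtn_eqF ki) add0r floorK ?oT //= -[in LHS]sT mxE; exact: T2.
- by rewrite -ik eqxx rmorphD /= floorK // -mulr2n -[T i i *+ 2]mulr_natl mulKf.
Qed.

Lemma fourier_char_shift U X Z : X^T = X ->
  fourier_char (2^-1 *: map_mx intr (U + U^T)) (Z + frac_mx X) =
  fourier_char (2^-1 *: map_mx intr (U + U^T)) Z * psi (\tr (U *m X)).
Proof.
move=> sX; rewrite /fourier_char /mod_char -cexpD -mulrDr mulmxDr linearD /=.
congr (cexp (_ * (_ + _))).
have -> : map_mx ratr (2^-1 *: map_mx intr (U + U^T)) =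
    2^-1 *: map_mx (intr : int -> C) (U + U^T).
  by apply/matrixP => i k; rewrite !mxE rmorphM /= fmorphV /= !ratr_nat ratr_int.
rewrite /frac_mx -scalemxAl -scalemxAr -map_mxM !linearZ /= trace_map_mx.
have -> : \tr ((U + U^T) *m X) = 2 * \tr (U *m X).
  rewrite mulmxDl linearD /= -[X in _ + \tr (_ *m X)]sX -trmx_mul mxtrace_tr.
  by rewrite mxtrace_mulC; ring.
by rewrite rmorphM /= mulrCA mulKf ?pnatr_eq0 // mulrC.
Qed.

Lemma compound_congr0_minors U :
  compound_congr0 j m.+1 (2^-1 *: map_mx intr (U + U^T)) <-> minors_cond m j U.
Proof. by apply: (@compound_congr0P _ _ M) => //; exact: even_sym_double. Qed.

Lemma cvg_seq_sum (S : Type) (G : set_system S) (FG : Filter G)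
    (K : numFieldType) (V : normedModType K) (I : Type) (r : seq I) (P : pred I)
    (f : I -> S -> V) (l : I -> V) :
  (forall i, P i -> f i @ G --> l i) ->
  (fun x => \sum_(i <- r | P i) f i x) @ G --> \sum_(i <- r | P i) l i.
Proof.
move=> cf; elim: r => [|i r IH].
  have -> : (fun x => \sum_(i <- [::] | P i) f i x) = cst 0.
    by apply/funext => y; rewrite big_nil.
  by rewrite big_nil; exact: cvg_cst.
rewrite big_cons; have [Pi|Pi] := boolP (P i).
  have -> : (fun y => \sum_(k <- i :: r | P k) f k y) =
      f i \+ (fun y => \sum_(k <- r | P k) f k y).
    by apply/funext => y; rewrite big_cons Pi.
  by apply: cvgD => //; exact: cf.
have -> // : (fun y => \sum_(k <- i :: r | P k) f k y) =
    (fun y => \sum_(k <- r | P k) f k y).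
by apply/funext => y; rewrite big_cons (negbTE Pi).
Qed.

Lemma minor_congr_part_no_expansion F :
  (forall a, ~ fourier_expansion F a) -> minor_congr_part j m.+1 F = fun=> 0.
Proof.
move=> nF; apply/funext => Z; rewrite /minor_congr_part.
have -> : fourier_coef F = fun=> 0 by apply: xgetPN.
rewrite /sum; have -> : partial_sum (fourier_term (@half_integral n `&` compound_congr0 j m.+1)
    (fun=> 0 : C) Z) = cst 0.
  apply/funext => A; rewrite /partial_sum big1 // => T _.
  by rewrite /fourier_term mul0r; case: ifP.
by apply: cvg_lim; [exact: norm_hausdorff|exact: cvg_cst].
Qed.

Definition shift_sum F Z : C := \sum_(X | symmetric_mx (rep X))
  fourier_weight R m j (rep X) * F (Z + frac_mx (rep X)).

(** The identity already holds for partial sums over any finite set of T, term by term through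
    [fourier_inversion]. The limit then only involves convergence of the expansion at the finitely
    many points Z + X/M. *)
Lemma minor_congr_part_shift : exists K : C, forall F a, fourier_expansion F a ->
  forall Z, siegel_space Z ->
  minor_congr_part j m.+1 F Z = K * shift_sum F Z.
Proof.
have [K K0 inv] := @fourier_inversion R n m j.
exists K^-1 => F a0 exF0 Z hZ; rewrite /minor_congr_part /sum.
have exF : fourier_expansion F (fourier_coef F) by apply: xgetI exF0.
move: (fourier_coef F) exF => a exF {a0 exF0}.
have -> : partial_sum (fourier_term (@half_integral n `&` compound_congr0 j m.+1) a Z) =
  (fun A => K^-1 * \sum_(X | symmetric_mx (rep X)) fourier_weight R m j (rep X) *
    partial_sum (fourier_term (@half_integral n) a (Z + frac_mx (rep X))) A).
  apply/funext => A; rewrite /partial_sum.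
  under [in RHS]eq_bigr => X _ do rewrite mulr_sumr.
  rewrite exchange_big mulr_sumr /=; apply: eq_bigr => T _.
  move: (val T) => {}T; rewrite /fourier_term.
  have [hT|nT] := pselect (half_integral T); last first.
    rewrite !asboolF //; last by move=> [].
    by rewrite big1 ?mulr0 // => X _; rewrite mulr0.
  have [U TU] := half_integral_symmetrize hT.
  transitivity (K^-1 * (a T * fourier_char T Z * if `[< minors_cond m j U >] then K else 0)).
    have -> : `[< (half_integral (n:=n) `&` compound_congr0 j m.+1) T >] = `[< minors_cond m j U >].
      apply: asbool_equiv_eq; rewrite -compound_congr0_minors -TU.
      by split=> [[]|].
    by case: ifP => _; rewrite ?mulr0 // [RHS]mulrC mulfK.
  rewrite -inv mulr_sumr; congr (_ * _); apply: eq_bigr => X /eqP sX.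
  rewrite asboolT // TU fourier_char_shift //; ring.
apply: cvg_lim; first exact: norm_hausdorff.
apply: cvgMl_tmp.
apply: cvg_seq_sum => X /eqP sX; apply: cvgMl_tmp; apply: exF.
by apply: siegel_space_shift => //; [exact: frac_mx_sym|exact: frac_mx_Im].
Qed.

End ShiftFormula.

(** * Transformation behaviour of the sum of shifts *)

Section Transformation.
Local Open Scope classical_set_scope.
Variables (R : realType) (n m : nat).
Local Notation C := R[i].
Local Notation M := (m.+1%:Z).
Local Notation rep := (@mx_rep n m).
Local Notation frac := (@frac_mx R n m).
Local Notation cint := (map_mx (intr : int -> C)).
Implicit Types (Z : 'M[C]_n) (X : 'M[int]_n) (F : 'M[C]_n -> C).

(** This is t(X/M) g = g' t(X'/M) read through the slash operator. Translations have automorphy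
    factor 1, so g' at Z + X'/M and g at Z share the same factor. *)
Lemma slash_twist (k N : nat) (A B C0 D X : 'M[int]_n) F Z :
  let g := block_mx A B ((N%:Z * M ^+ 2) *: C0) D in
  Sp n g -> siegel_space Z ->
  slash k F (twist m N A B C0 D X) (Z + frac (D^T *m X *m D)) =
  slash k (fun W => F (W + frac X)) g Z.
Proof.
move=> g gSp hZ; set X' := D^T *m X *m D; set s : C := m.+1%:R^-1.
have sM : s * M%:~R = 1 by rewrite mulVf // pnatr_eq0.
have CE' : cint ((N%:Z * M ^+ 2) *: C0) = (N%:~R * M%:~R ^+ 2) *: cint C0.
  by rewrite map_mxZ rmorphM rmorphXn.
have CE : cint (dlsubmx g) = (N%:~R * M%:~R ^+ 2) *: cint C0.
  by rewrite /g block_mxKdl.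
have X'E : cint X' = (cint D)^T *m cint X *m cint D by rewrite map_trmx -!map_mxM.
have autE : automorphy (twist m N A B C0 D X) (Z + frac X') = automorphy g Z.
  rewrite /automorphy /twist CE block_mxKdl block_mxKdr /g block_mxKdr.
  rewrite CE' map_mxB map_mxZ map_mxM rmorphM /= -/X' mulmxDr /frac_mx -/s.
  rewrite -addrA; congr (_ + _).
  rewrite -scalemxAl -scalemxAr scalerA addrCA.
  have -> : N%:~R * M%:~R ^+ 2 * s = N%:~R * M%:~R :> C.
    by rewrite expr2 mulrA -mulrA [_ * s]mulrC sM mulr1.
  by rewrite subrr addr0.
rewrite /slash autE; congr (_ * F _).
rewrite /moebius autE; have u := automorphy_unit gSp hZ.
apply: (can_inj (mulmxK u)).
rewrite mulmxKV // [RHS]mulmxDl mulmxKV //.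
rewrite /twist block_mxKul block_mxKur -/X'.
have ABC : cint A *m (cint D)^T - cint B *m (cint (dlsubmx g))^T = 1%:M.
  rewrite !map_trmx -!map_mxM -map_mxB /g block_mxKdl.
  by rewrite (Sp_tr gSp) map_mx1.
have := @twist_numerator _ _ s M%:~R N%:~R _ _ _ _ _ (cint X) Z sM CE ABC.
rewrite /= -X'E /automorphy {2}/g block_mxKdr {1 2}/g block_mxKul block_mxKur => <-.
rewrite /frac_mx -/s; congr (_ *m _ + _).
  by rewrite map_mxD map_mxZ map_mxM rmorphM.
by rewrite !map_mxB !map_mxZ !map_mxM !rmorphM /= map_trmx.
Qed.

Lemma slash_translation (k : nat) F Z (S : 'M[int]_n) : siegel_space Z ->
  slash k F (block_mx 1%:M S 0 1%:M) Z = F (Z + cint S).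
Proof.
move=> hZ; rewrite /slash /moebius /automorphy !block_mxKul !block_mxKur !block_mxKdl !block_mxKdr.
rewrite map_mx0 !map_mx1 mul0mx add0r mul1mx invmx1 mulmx1 det1 expr1n invr1.
by rewrite mul1r.
Qed.

Lemma translation_Sp (S : 'M[int]_n) : S^T = S -> Sp n (block_mx 1%:M S 0 1%:M).
Proof.
move=> sS; apply/SpP; split; rewrite ?trmx0 ?trmx1 ?mulmx0 ?mul0mx ?mulmx1 ?mul1mx ?subr0 //.
Qed.

(* Instantiated with [G0] and [G1] the groups Gamma1 or Gamma0 of levels N and
   N M^2. *)
Lemma modular_shift_sum (k j N : nat) (G0 G1 : set 'M[int]_(n + n)) (chi : int -> C) F :
  chi 1 = 1 ->
  (forall S : 'M[int]_n, S^T = S -> G0 (block_mx 1%:M S 0 1%:M)) ->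
  (forall g, G1 g -> Sp n g /\ mx_congr (N * m.+1 ^ 2) (dlsubmx g) 0) ->
  (forall A B C0 D X, X^T = X -> G1 (block_mx A B ((N%:Z * M ^+ 2) *: C0) D) ->
     G0 (twist m N A B C0 D X) /\
     chi (\det (drsubmx (twist m N A B C0 D X))) = chi (\det D)) ->
  (forall g, G0 g -> forall Z, siegel_space Z ->
     slash k F g Z = chi (\det (drsubmx g)) * F Z) ->
  forall g, G1 g -> forall Z, siegel_space Z ->
  slash k (shift_sum m j F) g Z = chi (\det (drsubmx g)) * shift_sum m j F Z.
Proof.
move=> chi1 G0t G1Sp G1tw modF g G1g Z hZ.
have [gSp gC] := G1Sp g G1g.
have [A [B [C0 [D gE]]]] : exists A B C0 D, g = block_mx A B ((N%:Z * M ^+ 2) *: C0) D.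
  exists (ulsubmx g), (ursubmx g),
    (map_mx (fun x => (x %/ (N * m.+1 ^ 2)%N)%Z) (dlsubmx g)), (drsubmx g).
  rewrite -[LHS]submxK; congr block_mx; apply/matrixP => i l.
  have := gC i l; rewrite [in RHS]mxE mod0z => /eqP gd.
  rewrite [RHS]mxE [X in _ * X]mxE; move/eqP/dvdz_mod0P/divzK: gd => {1}<-.
  by rewrite mulrC expr2 -!PoszM mulnn.
have AD : A *m D^T - B *m ((N%:Z * M ^+ 2) *: C0)^T = 1%:M by apply: Sp_tr; rewrite -gE.
have /SpP[_ _ DA] : Sp n (block_mx A B ((N%:Z * M ^+ 2) *: C0) D) by rewrite -gE.
have MM : M * (N%:Z * M) = N%:Z * M ^+ 2 by ring.
(* [cAD] makes V |-> A V A^T an inverse modulo M of X |-> D^T X D; [cDA] is the form needed for the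
   invariance of the weights. *)
have cAD : mx_cong m (A *m D^T) 1%:M.
  exists ((N%:Z * M) *: (B *m C0^T)); rewrite -AD linearZ /= -scalemxAr scalerA.
  by rewrite MM subrK.
have cDA : mx_cong m (A^T *m D) 1%:M.
  exists ((N%:Z * M) *: (C0^T *m B)); rewrite -DA linearZ /= -scalemxAl scalerA.
  by rewrite MM subrK.
rewrite {1}/slash /shift_sum [LHS]mulr_sumr; set f := fun V : 'M[int]_n => fourier_weight R m j V * F (Z + frac V).
transitivity (\sum_(X | symmetric_mx (rep X))
   chi (\det D) * f (D^T *m rep X *m D) : C).
  apply: eq_bigr => X /eqP sX; rewrite /f (fourier_weight_congruence R j (rep X) cDA).
  rewrite [LHS]mulrCA [RHS]mulrCA; congr (_ * _).
  have G1g' : G1 (block_mx A B ((N%:Z * M ^+ 2) *: C0) D) by rewrite -gE.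
  have [tG0 <-] := G1tw A B C0 D (rep X) sX G1g'.
  rewrite -modF //; last first.
    by apply: siegel_space_shift => //; [apply: frac_mx_sym; rewrite !trmx_mul trmxK sX mulmxA|exact: frac_mx_Im].
  by rewrite slash_twist -?gE.
rewrite -[LHS]mulr_sumr {1}gE block_mxKdr; congr (_ * _).
rewrite -[RHS]/(\sum_(X | symmetric_mx (rep X)) f (rep X)).
apply: (@sum_reindex_mod n m _ (@symmetric_mx n) (fun V => D^T *m V *m D)
   (fun V => A *m V *m A^T) f).
- exact: mx_rep_red_sym.
- by move=> V /eqP sV; rewrite /symmetric_mx !trmx_mul trmxK sV mulmxA.
- move=> U V UV; apply: mx_cong_mul (mx_cong_refl m _).
  exact: mx_cong_mul (mx_cong_refl m _) UV.
- move=> V _.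
  have -> : A *m (D^T *m V *m D) *m A^T = (A *m D^T) *m V *m (A *m D^T)^T.
    by rewrite trmx_mul trmxK !mulmxA.
  have /mx_cong_mul := mx_cong_mul cAD (mx_cong_refl m V).
  by move=> /(_ _ _ (mx_cong_tr cAD)); rewrite trmx1 mulmx1 mul1mx.
(* Congruent symmetric [U] and [V] differ by M times a symmetric [W], so the two arguments of F
   differ by an integral translation, which lies in [G0] and has lower right block 1. *)
- move=> U V /eqP sU /eqP sV UV; rewrite /f (fourier_weight_cong _ _ UV); congr (_ * _).
  have [W UE] := UV.
  have sW : W^T = W.
    have : M *: W^T = M *: W.
      by apply: (addrI V); rewrite -UE -{1}sV -linearZ -linearD /= -UE.
    move/matrixP => H; apply/matrixP => a b; have := H a b; rewrite !mxE.
    exact: mulfI.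
  have -> : Z + frac U = (Z + frac V) + cint W.
    rewrite -addrA UE /frac_mx map_mxD map_mxZ scalerDr scalerA.
    by rewrite mulVf ?scale1r // pnatr_eq0.
  have hV : siegel_space (Z + frac V).
    by apply: siegel_space_shift => //; [exact: frac_mx_sym|exact: frac_mx_Im].
  rewrite -(slash_translation k F W hV) modF ?block_mxKdr ?det1 ?chi1 ?mul1r //.
  exact: G0t.
Qed.

End Transformation.

(** * Regularity at the cusps *)

Section Cusps.
Variables (R : realType) (k : nat).
Local Notation C := R[i].

Lemma Re_normM (u : C) (B : R) : (complex.Re `|u| * B)%:C = `|u| * B%:C.
Proof. by rewrite rmorphM normc_def. Qed.

Section Closure.
Variable n : nat.
Implicit Types F : 'M[C]_n -> C.

Lemma bounded_at_cusps_eq F G : {in @siegel_space R n, F =1 G} ->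
  bounded_at_cusps k F -> bounded_at_cusps k G.
Proof.
move=> FG bF g gSp; have [y [B H]] := bF g gSp; exists y, B => Z hZ hy.
rewrite /slash -FG; first exact: H.
by rewrite inE; exact: moebius_siegel_space.
Qed.

Lemma bounded_at_cusps0 : bounded_at_cusps k (fun _ : 'M[C]_n => 0).
Proof. by move=> g _; exists 0, 0 => Z _ _; rewrite /slash mulr0 normr0. Qed.

Lemma bounded_at_cuspsD F G : bounded_at_cusps k F -> bounded_at_cusps k G ->
  bounded_at_cusps k (fun Z => F Z + G Z).
Proof.
move=> bF bG g gSp; have [y [B H]] := bF g gSp; have [y' [B' H']] := bG g gSp.
exists (Num.max y y'), (B + B') => Z hZ hy.
rewrite /slash mulrDr rmorphD /=; apply: le_trans (ler_normD _ _) _.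
apply: lerD; [apply: H|apply: H'] => // i; apply: le_trans (hy i);
  by rewrite le_max lexx ?orbT.
Qed.

Lemma bounded_at_cuspsZ (c : C) F : bounded_at_cusps k F ->
  bounded_at_cusps k (fun Z => c * F Z).
Proof.
move=> bF g gSp; have [y [B H]] := bF g gSp.
exists y, (complex.Re `|c| * B) => Z hZ hy.
rewrite /slash mulrCA normrM Re_normM.
by rewrite ler_wpM2l //; exact: H.
Qed.

Lemma bounded_at_cusps_sum (I : Type) (r : seq I) (P : pred I)
    (F : I -> 'M[C]_n -> C) :
  (forall i, P i -> bounded_at_cusps k (F i)) ->
  bounded_at_cusps k (fun Z => \sum_(i <- r | P i) F i Z).
Proof.
move=> hF; elim: r => [|i r IH].
  have -> : (fun Z => \sum_(i <- [::] | P i) F i Z) = (fun=> 0).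
    by apply/funext => Z; rewrite big_nil.
  exact: bounded_at_cusps0.
have [Pi|Pi] := boolP (P i).
  have -> : (fun Z => \sum_(l <- i :: r | P l) F l Z) =
      (fun Z => F i Z + \sum_(l <- r | P l) F l Z).
    by apply/funext => Z; rewrite big_cons Pi.
  by apply: bounded_at_cuspsD => //; exact: hF.
have -> : (fun Z => \sum_(l <- i :: r | P l) F l Z) =
    (fun Z => \sum_(l <- r | P l) F l Z) => //.
by apply/funext => Z; rewrite big_cons (negbTE Pi).
Qed.

End Closure.

Section GenusOne.
Implicit Types (Z : 'M[C]_1) (p q r t : int).

Definition mx22 p q r t : 'M[int]_(1 + 1) := block_mx p%:M q%:M r%:M t%:M.

Lemma mx22_Sp p q r t : Sp 1 (mx22 p q r t) <-> p * t - q * r = 1.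
Proof.
rewrite SpP !tr_scalar_mx -!scalar_mxM -raddfB /= -[_ p r]mulrC -[_ q t]mulrC.
split=> [[_ _ /(congr1 (fun A : 'M[int]_1 => A 0 0))]|E].
  by rewrite !mxE /= !mulr1n [r * q]mulrC.
by split=> //; congr _%:M; rewrite -E [r * q]mulrC.
Qed.

Lemma mx22_eta (g : 'M[int]_(1 + 1)) : exists p q r t, g = mx22 p q r t.
Proof.
exists (ulsubmx g 0 0), (ursubmx g 0 0), (dlsubmx g 0 0), (drsubmx g 0 0).
by rewrite /mx22 -!mx11_scalar submxK.
Qed.

Lemma slash22 F p q r t Z :
  slash k F (mx22 p q r t) Z =
  (r%:~R * Z 0 0 + t%:~R) ^- k *
    F ((p%:~R * Z 0 0 + q%:~R) / (r%:~R * Z 0 0 + t%:~R))%:M.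
Proof.
have aE : automorphy (mx22 p q r t) Z = (r%:~R * Z 0 0 + t%:~R)%:M.
  rewrite /automorphy /mx22 block_mxKdl block_mxKdr !map_scalar_mx.
  by rewrite [X in _ *m X]mx11_scalar -scalar_mxM -raddfD.
rewrite /slash /moebius aE det_scalar1 invmx_scalar.
rewrite /mx22 block_mxKul block_mxKur !map_scalar_mx.
by rewrite [X in _ *m X + _]mx11_scalar -!(scalar_mxM, raddfD).
Qed.

Lemma siegel_space1 (z : C) : siegel_space (z%:M : 'M[C]_1) <-> 0 < complex.Im z.
Proof.
have qE (v : 'cV[R]_1) :
    (v^T *m map_mx (@complex.Im R) (z%:M) *m v) 0 0 = complex.Im z * v 0 0 ^+ 2.
  rewrite [v]mx11_scalar tr_scalar_mx -mulmxA !mul_scalar_mx !mxE.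
  by rewrite big_ord1 !mxE eqxx !mulr1n; ring.
split=> [[_ /(_ 1%:M)]|z0].
  rewrite qE !mxE mulr1n expr1n mulr1; apply; exact: matrix_nonzero1.
split=> [|v v0]; first exact: tr_scalar_mx.
rewrite qE mulr_gt0 // exprn_even_gt0 //=.
by apply: contra v0 => /eqP v0; rewrite [v]mx11_scalar v0 raddf0.
Qed.

Lemma siegel_space1_entry Z : siegel_space Z -> 0 < complex.Im (Z 0 0).
Proof. by rewrite {1}[Z]mx11_scalar siegel_space1. Qed.

(* Hermite normal form: M t(x/M) g = g' (a b; 0 d) with g' in SL_2(Z), a, d > 0
   and ad = M^2. *)
Lemma hermite_shift (m x p q r t : int) : 0 < m -> p * t - q * r = 1 ->
  exists p' q' r' t' a b d : int,
  [/\ p' * t' - q' * r' = 1, 0 < a, 0 < d,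
    [/\ m * p + x * r = p' * a & m * r = r' * a] &
    m * q + x * t = p' * b + q' * d /\ m * t = r' * b + t' * d].
Proof.
move=> m0 det1; set h1 := m * p + x * r; set h2 := m * r.
set h12 := m * q + x * t; set h22 := m * t.
have det : h1 * h22 - h12 * h2 = m ^+ 2.
  by rewrite -[RHS]mulr1 -det1 /h1 /h2 /h12 /h22; ring.
(* The first column of M t(x/M) g, divided by its gcd [a], is completed by Bezout to a matrix of
   determinant 1. Its inverse, applied to the second column, gives [b] and [d]. *)
set a := gcdz h1 h2.
have a0 : 0 < a.
  rewrite lt_neqAle eq_sym gcdz_eq0 negb_and; apply/andP; split; last by [].
  rewrite -negb_and; apply/negP => /andP[/eqP e1 /eqP e2].
  by move: det; rewrite e1 e2 mul0r mulr0 subrr => /esym/eqP; rewrite expf_eq0 /= gt_eqF.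
have /dvdzP[u1 E1] : (a %| h1)%Z by exact: dvdz_gcdl.
have /dvdzP[u2 E2] : (a %| h2)%Z by exact: dvdz_gcdr.
have [[e f] /= Eef] : exists ef : int * int, u1 * ef.1 - ef.2 * u2 = 1.
  have [e [f E]] := Bezoutz h1 h2.
  exists (e, - f); apply: (mulIf (negbT (gt_eqF a0))) => /=.
  by rewrite mul1r -[RHS]E E1 E2; ring.
exists u1, f, u2, e, a, (e * h12 - f * h22), (u1 * h22 - u2 * h12).
have ad : a * (u1 * h22 - u2 * h12) = m ^+ 2 by rewrite -det E1 E2; ring.
split=> //.
- by rewrite -(pmulr_rgt0 _ a0) ad exprn_gt0.
- split.
    by transitivity ((u1 * e - f * u2) * h12); [rewrite Eef mul1r|ring].
  by transitivity ((u1 * e - f * u2) * h22); [rewrite Eef mul1r|ring].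
Qed.

(** The triangular factor sends z to w = (az + b)/d with Im w = (a/d) Im z, so growth of Im z
    becomes growth of Im w. Behaviour of the shifted function at the cusp of g is thus behaviour of
    [F] at the cusp of g'. *)
Lemma bounded_at_cusps_shift (n m : nat) (X : 'M[int]_n) (F : 'M[C]_n -> C) :
  n = 1%N -> bounded_at_cusps k F ->
  bounded_at_cusps k (fun Z : 'M[C]_n => F (Z + frac_mx R m X)).
Proof.
move=> n1; subst n => bF g; have [p [q [r [t ->]]]] := mx22_eta g => gSp.
have det1 := (mx22_Sp p q r t).1 gSp.
have [p' [q' [r' [t' [a [b [d [det1' a0 d0 [E1 E2] [E12 E22]]]]]]]]] :=
  @hermite_shift m.+1%:Z (X 0 0) p q r t isT det1.
have gSp' := (mx22_Sp p' q' r' t').2 det1'.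
have [y [B bFg]] := bF _ gSp'.
have aR : 0 < a%:~R :> R by rewrite ltr0z.
have dR : 0 < d%:~R :> R by rewrite ltr0z.
pose M : C := m.+1%:R.
(* The threshold rescales by d/a. The automorphy factor of g' at w is M/d times that of g at z,
   which puts (M/d)^k into the bound. *)
exists (y * d%:~R / a%:~R), (complex.Re (`|(M / d%:~R) ^+ k|) * B) => Z hZ /(_ 0) hy.
have iZ := siegel_space1_entry hZ; set z := Z 0 0 in hy iZ *.
pose w : C := (a%:~R * z + b%:~R) / d%:~R.
have dC : d%:~R != 0 :> C by rewrite intr_eq0 gt_eqF.
have MC : M != 0 by rewrite pnatr_eq0.
have iw : complex.Im w = a%:~R / d%:~R * complex.Im z.
  have -> : w = (a%:~R / d%:~R : R)%:C * z + (b%:~R / d%:~R : R)%:C.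
    rewrite !rmorphM /= !fmorphV /= !rmorph_int /w; field.
    exact: dC.
  by case: (z) => z1 z2 /=; rewrite mul0r addr0 addr0.
have hw : siegel_space (w%:M : 'M[C]_1).
  by apply/siegel_space1; rewrite iw mulr_gt0 // divr_gt0.
have hwy i : y <= complex.Im ((w%:M : 'M[C]_1) i i).
  rewrite mxE eqxx mulr1n iw -ler_pdivrMl ?divr_gt0 //.
  by rewrite invf_div mulrC mulrA.
have cE (u v : int) : u = v -> u%:~R = v%:~R :> C by move=> ->.
have {}E1 := cE _ _ E1; have {}E2 := cE _ _ E2.
have {}E12 := cE _ _ E12; have {}E22 := cE _ _ E22.
rewrite !(rmorphD, rmorphM) /= -[(m.+1%:Z)%:~R]/M in E1 E2 E12 E22.
have rz0 : r%:~R * z + t%:~R != 0.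
  have := automorphy_unit gSp hZ; rewrite unitmxE /automorphy /mx22 block_mxKdl block_mxKdr.
  rewrite !map_scalar_mx [X in _ *m X]mx11_scalar -scalar_mxM -raddfD /= det_scalar1.
  by rewrite unitfE.
have denE : r'%:~R * w + t'%:~R = (M / d%:~R) * (r%:~R * z + t%:~R).
  have -> : (M / d%:~R) * (r%:~R * z + t%:~R) = ((M * r%:~R) * z + M * t%:~R) / d%:~R.
    by field.
  by rewrite E2 E22 /w; field.
have numE : p'%:~R * w + q'%:~R = (M / d%:~R) * (p%:~R * z + q%:~R + (X 0 0)%:~R / M * (r%:~R * z + t%:~R)).
  have -> : (M / d%:~R) * (p%:~R * z + q%:~R + (X 0 0)%:~R / M * (r%:~R * z + t%:~R)) =
    ((M * p%:~R + (X 0 0)%:~R * r%:~R) * z + (M * q%:~R + (X 0 0)%:~R * t%:~R)) / d%:~R.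
    by field; rewrite dC nat1r pnatr_eq0.
  by rewrite E1 E12 /w; field.
have Md : M / d%:~R != 0 by rewrite mulf_neq0 // invr_eq0.
have := bFg _ hw hwy; rewrite !slash22 -/z mxE eqxx mulr1n.
rewrite denE numE -[(M / d%:~R * _) / _]mulf_div divff // mul1r mulrDl mulfK //.
have -> : (((p%:~R * z + q%:~R) / (r%:~R * z + t%:~R) + (X 0 0)%:~R / M)%:M : 'M[C]_1) =
  ((p%:~R * z + q%:~R) / (r%:~R * z + t%:~R))%:M + frac_mx R m X.
  rewrite raddfD /=; congr (_ + _); rewrite [frac_mx R m X]mx11_scalar !mxE.
  by rewrite mulrC.
rewrite exprMn invfM -mulrA normrM normfV => H.
move: H; have := expf_neq0 k Md; move: ((M / d%:~R) ^+ k) => u u0 H.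
by rewrite Re_normM -ler_pdivrMl // normr_gt0.
Qed.

End GenusOne.
End Cusps.

(** * Assembly for an abstract pair of groups, then for [Gamma1] and [Gamma0] *)

Lemma minor_congr_part_modular (R : realType) (k j n m N : nat)
    (G0 G1 : set 'M[int]_(n + n)) (chi : int -> R[i]) (F : 'M[R[i]]_n -> R[i]) :
  chi 1 = 1 ->
  (forall S : 'M[int]_n, S^T = S -> G0 (block_mx 1%:M S 0 1%:M)) ->
  (forall g, G1 g -> Sp n g /\ mx_congr (N * m.+1 ^ 2) (dlsubmx g) 0) ->
  (forall A B C0 D X, X^T = X -> G1 (block_mx A B ((N%:Z * m.+1%:Z ^+ 2) *: C0) D) ->
     G0 (twist m N A B C0 D X) /\
     chi (\det (drsubmx (twist m N A B C0 D X))) = chi (\det D)) ->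
  modular_forms k G0 chi F -> modular_forms k G1 chi (minor_congr_part j m.+1 F).
Proof.
move=> chi1 G0t G1Sp G1tw [holF modF cuspF].
have [[a exF]|nex] := pselect (exists a, fourier_expansion F a); last first.
  rewrite minor_congr_part_no_expansion; last by move=> a exF; apply: nex; exists a.
  split=> [|g _ Z _|_]; [exact: siegel_holomorphic0| |exact: bounded_at_cusps0].
  by rewrite /slash !mulr0.
have [K partE] := @minor_congr_part_shift R n m j.
set H := shift_sum m j F.
have HE : {in @siegel_space R n, (fun Z => K * H Z) =1 minor_congr_part j m.+1 F}.
  by move=> Z; rewrite inE => hZ; rewrite (partE _ _ exF Z hZ).
split.
- apply: (siegel_holomorphic_eq HE); apply: siegel_holomorphicZ.
  apply: siegel_holomorphic_sum => X /eqP sX; apply: siegel_holomorphicZ.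
  by apply: siegel_holomorphic_shift => //; [exact: frac_mx_sym|exact: frac_mx_Im].
- move=> g G1g Z hZ; have [gSp _] := G1Sp g G1g.
  rewrite /slash -!HE ?inE //; last exact: moebius_siegel_space.
  have := modular_shift_sum j chi1 G0t G1Sp G1tw modF G1g hZ.
  by rewrite /slash => HZ; rewrite [LHS]mulrCA HZ [RHS]mulrCA.
- move=> n1; apply: (bounded_at_cusps_eq HE); apply: bounded_at_cuspsZ.
  apply: bounded_at_cusps_sum => X _; apply: bounded_at_cuspsZ.
  by apply: bounded_at_cusps_shift => //; exact: cuspF.
Qed.

Lemma twist_congr n m N (A B C0 D X : 'M[int]_n) :
  [/\ mx_congr N (dlsubmx (twist m N A B C0 D X)) 0,
      mx_congr N (ulsubmx (twist m N A B C0 D X)) A &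
      mx_congr N (drsubmx (twist m N A B C0 D X)) D].
Proof.
rewrite /twist block_mxKul block_mxKdl block_mxKdr; split=> i l.
- by rewrite !mxE mod0z -mulrA mulrC modzMl.
- by rewrite !mxE -mulrA [N%:Z * _]mulrC addrC modzMDl.
- by rewrite !mxE -mulrA -mulrN [N%:Z * _]mulrC addrC modzMDl.
Qed.

Lemma mx_congr_dvd n (d N : nat) (A B : 'M[int]_n) : (d %| N)%N ->
  mx_congr N A B -> mx_congr d A B.
Proof.
move=> dN AB i l; apply/eqP; rewrite eqz_mod_dvd.
by apply: (@dvdz_trans N%:Z) => //; rewrite -eqz_mod_dvd; apply/eqP; exact: AB.
Qed.

Lemma mx_congr_trans n N (A B D : 'M[int]_n) :
  mx_congr N A B -> mx_congr N B D -> mx_congr N A D.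
Proof. by move=> AB BD i l; rewrite AB BD. Qed.

Theorem theorem4p1 (R : realType) (k j n M N : nat)
    (k_gt0 : (0 < k)%N) (j_gt0 : (0 < j)%N) (n_gt0 : (0 < n)%N)
    (M_gt0 : (0 < M)%N) (N_gt0 : (0 < N)%N) (le_jn : (j <= n)%N) :
  (forall F : 'M[R[i]]_n -> R[i],
     modular_forms k (Gamma1 n N) (fun=> 1) F ->
     modular_forms k (Gamma1 n (N * M ^ 2)%N) (fun=> 1) (minor_congr_part j M F))
  /\
  (forall (chi : int -> R[i]) (F : 'M[R[i]]_n -> R[i]),
     dirichlet_character N chi ->
     modular_forms k (Gamma0 n N) chi F ->
     modular_forms k (Gamma0 n (N * M ^ 2)%N) chi (minor_congr_part j M F)).
Proof.
case: M M_gt0 => // m _; split=> [F|chi F [chi1 chiM chiN chi0]];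
  apply: (@minor_congr_part_modular R k j n m N).
- by [].
- move=> S sS; rewrite /Gamma1 /= block_mxKul block_mxKdl block_mxKdr.
  by split=> //; exact: translation_Sp.
- by move=> g [gSp gC _ _].
- move=> A B C0 D X sX [gSp _]; rewrite block_mxKul block_mxKdr => gA gD; split=> //.
  have [tC tA tD] := twist_congr m N A B C0 D X.
  have NM : (N %| N * m.+1 ^ 2)%N by rewrite dvdn_mulr.
  split; [exact: twist_Sp|exact: tC| |].
    by apply: mx_congr_trans tA _; exact: mx_congr_dvd gA.
  by apply: mx_congr_trans tD _; exact: mx_congr_dvd gD.
- by [].
- move=> S sS; split; first exact: translation_Sp.
  by rewrite block_mxKdl.
- by move=> g [gSp gC].
- move=> A B C0 D X sX [gSp _]; have [tC tA tD] := twist_congr m N A B C0 D X.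
  split; first by split; [exact: twist_Sp|exact: tC].
  have chi_nat (a : int) (q : nat) : chi (a + N%:Z * q%:Z) = chi a.
    elim: q => [|q IH]; first by rewrite mulr0 addr0.
    by rewrite intS mulrDr mulr1 addrCA addrC chiN.
  have chi_int (a q : int) : chi (a + N%:Z * q) = chi a.
    have [|p|p] := intP q; [by rewrite mulr0 addr0|exact: chi_nat|].
    by rewrite -(chi_nat _ p.+1) mulrN subrK.
  (* The lower right block of the twist differs from [D] by a multiple of N, hence so does its
     determinant, and [chi] has period N. *)
  have [|q ->] := @det_congr _ _ N%:Z (drsubmx (twist m N A B C0 D X)) D.
    move=> i l; exists (- (m.+1%:Z * (C0 *m (D^T *m X *m D)) i l)).
    by rewrite /twist block_mxKdr !mxE mulrN mulrA.
  exact: chi_int.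
Qed.
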